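(* Let $(\Omega,\mathcal{M},\mu)$ be a $\sigma$-finite, complete measure space and let $p\in\mathcal{P}(\Omega,\mu)$ be a bounded variable exponent (that is, $p^+<\infty$). Then the variable exponent Lebesgue space $L^{p(\cdot)}(\mu)$ has the bounded approximation property.
   Context: $\mathcal{P}(\Omega,\mu)$ denotes the set of all $\mu$-measurable functions $p:\Omega\to[1,\infty]$ (variable exponents), and $p^+:=\operatorname{ess\,sup}_{x\in\Omega}p(x)$; $p$ is bounded if $p^+<\infty$. For a bounded exponent $p$ and a measurable function $f:\Omega\to\mathbb{R}$, the modular is $\rho_{p(\cdot)}(f):=\int_\Omega |f(x)|^{p(x)}\,d\mu(x)$, and $\|f\|_{L^{p(\cdot)}(\mu)}:=\inf\{\lambda>0:\rho_{p(\cdot)}(f/\lambda)\le 1\}$. The space $L^{p(\cdot)}(\mu)$ is the Banach space of (classes, modulo $\mu$-a.e. equality, of) measurable functions $f$ with $\|f\|_{L^{p(\cdot)}(\mu)}<\infty$. A Banach space $\mathcal{B}$ has the bounded approximation property if there is a constant $M>0$ such that for every compact set $K\subset\mathcal{B}$ and every $\epsilon>0$ there is a finite rank bounded linear operator $F$ on $\mathcal{B}$ with $\|F\|\le M$ and $\|x-Fx\|<\epsilon$ for all $x\in K$. *)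

(* Defs.v *)
From HB Require Import structures.
From mathcomp Require Import all_boot all_order all_algebra.
From mathcomp Require Import all_classical all_reals all_analysis.
From mathcomp Require Import measurable_realfun ess_sup_inf.
From mathcomp Require Import ring lra.

Set Implicit Arguments.
Unset Strict Implicit.
Unset Printing Implicit Defensive.
Import Order.TTheory GRing.Theory Num.Def Num.Theory.
Import numFieldNormedType.Exports.

Local Open Scope classical_set_scope.
Local Open Scope ring_scope.

Definition variable_exponent d (T : measurableType d) (R : realType)
    (p : T -> \bar R) : Prop :=
  measurable_fun [set: T] p /\ forall x, (1 <= p x)%E.

(* Meant for exponents with [ess_sup mu p < +oo]: then [p x] is finite for
   almost every [x], and the junk value [fine +oo = 0] is irrelevant. *)
HB.lock Definition modular d (T : measurableType d) (R : realType)
    (mu : {measure set T -> \bar R}) (p : T -> \bar R) (f : T -> R) : \bar R :=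
  \int[mu]_x (`|f x| `^ fine (p x))%:E.
Canonical locked_modular := Unlockable modular.unlock.
Arguments modular {d T R} mu p f.

(* The value is [+oo] when no [l] is admissible. *)
HB.lock Definition luxemburg_norm d (T : measurableType d) (R : realType)
    (mu : {measure set T -> \bar R}) (p : T -> \bar R) (f : T -> R) : \bar R :=
  ereal_inf [set l%:E | l in
    [set l : R | 0 < l /\ (modular mu p (fun x => (f x / l)%R) <= 1)%E]].
Canonical locked_luxemburg_norm := Unlockable luxemburg_norm.unlock.
Arguments luxemburg_norm {d T R} mu p f.

Section luxemburg_theory.
Context d (T : measurableType d) (R : realType).
Variables (mu : {measure set T -> \bar R}) (p : T -> \bar R).
Hypotheses (hp : variable_exponent p) (pb : (ess_sup mu p < +oo)%E).
Implicit Types (f g : T -> R) (l a b : R).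
Local Notation r := (fun x => fine (p x)).
Local Notation rho := (modular mu p).
Local Notation N := (luxemburg_norm mu p).

Lemma exponent_ge1 : \forall x \ae mu, 1 <= r x.
Proof.
apply: filterS (ess_sup_ge mu p) => x px.
move: (hp.2 x) (le_lt_trans px pb); case: (p x) => [s| |] //=.
Qed.

Lemma measurable_exponent : measurable_fun [set: T] r.
Proof. by exact: measurableT_comp hp.1. Qed.

Lemma measurable_modular f : measurable_fun setT f ->
  measurable_fun setT (fun x => (`|f x| `^ r x)%:E).
Proof.
move=> mf; apply/measurable_EFinP; rewrite /powR.
have mnf : measurable_fun [set: T] (fun x => `|f x|) by exact: measurableT_comp.
have mr := measurable_exponent.
apply: measurable_fun_ifT => //.
- by apply: measurable_fun_eqr => //.
- rewrite [X in measurable_fun _ X](_ : _ = fun x => if r x == 0 then 1 else 0).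
    by apply: measurable_fun_ifT => //; exact: measurable_fun_eqr.
  by apply/funext => x; case: eqP.
- apply: measurableT_comp => //; apply: measurable_funM => //.
  by apply: measurableT_comp => //; exact: measurable_ln.
Qed.

Lemma modular_ge0 f : (0 <= rho f)%E.
Proof. by rewrite unlock; apply: integral_ge0 => x _; rewrite lee_fin. Qed.

Lemma le_modular f g : measurable_fun setT f -> measurable_fun setT g ->
  (\forall x \ae mu, `|f x| <= `|g x|) -> (rho f <= rho g)%E.
Proof.
move=> mf mg fg; rewrite unlock; apply: ae_ge0_le_integral => //.
- exact: measurable_modular.
- exact: measurable_modular.
apply: filterS2 exponent_ge1 fg => x r1 fgx _.
by rewrite lee_fin ge0_ler_powR// ?nnegrE// (le_trans _ r1).
Qed.

Lemma modular_convex f g a b :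
  measurable_fun setT f -> measurable_fun setT g ->
  0 <= a -> 0 <= b -> a + b = 1 ->
  (rho (fun x => (a * f x + b * g x)%R) <= a%:E * rho f + b%:E * rho g)%E.
Proof.
move=> mf mg a0 b0 ab.
have mF := measurable_modular mf; have mG := measurable_modular mg.
have p0 h x : (0 <= (`|h x| `^ r x)%:E :> \bar R)%E by rewrite lee_fin powR_ge0.
rewrite unlock -ge0_integralZl_EFin// -ge0_integralZl_EFin//.
rewrite -ge0_integralD//; first last.
- exact: measurable_funeM.
- by move=> x _; rewrite mule_ge0// lee_fin.
- exact: measurable_funeM.
- by move=> x _; rewrite mule_ge0// lee_fin.
apply: ae_ge0_le_integral => //.
- apply: measurable_modular; apply: measurable_funD; exact: measurable_funM.
- by move=> x _; rewrite adde_ge0// mule_ge0// lee_fin.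
- by apply: emeasurable_funD; exact: measurable_funeM.
apply: filterS exponent_ge1 => x r1 _.
rewrite -!EFinM -EFinD lee_fin.
apply: (@le_trans _ _ ((a * `|f x| + b * `|g x|) `^ r x)).
  rewrite ge0_ler_powR ?nnegrE ?addr_ge0 ?mulr_ge0//; first exact: le_trans r1.
  by rewrite (le_trans (ler_normD _ _))// !normrM (ger0_norm a0) (ger0_norm b0).
have a1 : a <= 1 by rewrite -ab lerDl.
have := @convex_powR R _ r1 (Itv01 a0 a1) `|f x| `|g x|.
rewrite !inE/= !in_itv/= !normr_ge0 => /(_ isT isT).
have b_def : 1 - a = b by rewrite -ab addrC addKr.
by rewrite convRE [X in X `^ _ <= _ -> _]convRE/= /unstable.onem b_def.
Qed.

Lemma modular0 : rho (fun=> 0) = 0%E.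
Proof.
rewrite unlock -[RHS](integral0 mu setT); apply: ge0_ae_eq_integral => //.
- exact: measurable_modular.
apply: filterS exponent_ge1 => x r1 _.
by rewrite normr0 powR0// gt_eqF// (lt_le_trans ltr01).
Qed.

Lemma luxemburg_norm_le f l : 0 < l ->
  (rho (fun x => (f x / l)%R) <= 1)%E -> (N f <= l%:E)%E.
Proof. by move=> l0 fl; rewrite unlock; apply: ereal_inf_lbound; exists l. Qed.

Lemma luxemburg_norm_lt f l : measurable_fun setT f -> (N f < l%:E)%E ->
  0 < l /\ (rho (fun x => (f x / l)%R) <= 1)%E.
Proof.
rewrite unlock => mf /ereal_inf_lt[_ [m [m0 fm] <-]]; rewrite lte_fin => ml.
have l0 : 0 < l := lt_trans m0 ml.
split => //; apply: le_trans fm; apply: le_modular.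
- exact: measurable_funM.
- exact: measurable_funM.
apply: nearW => x; rewrite !normrM ler_wpM2l// !normfV.
by rewrite lef_pV2 ?posrE ?normr_gt0 ?gt_eqF// !gtr0_norm// ltW.
Qed.

Lemma luxemburg_norm_ge0 f : (0 <= N f)%E.
Proof.
rewrite unlock; apply: le_ereal_inf_tmp => _ [l [l0 _] <-].
by rewrite lee_fin ltW.
Qed.

Lemma luxemburg_norm_fin f : (N f < +oo)%E -> N f \is a fin_num.
Proof. by move=> Nf; rewrite ge0_fin_numE// luxemburg_norm_ge0. Qed.

Lemma luxemburg_normD f g : measurable_fun setT f -> measurable_fun setT g ->
  (N (f \+ g)%R <= N f + N g)%E.
Proof.
move=> mf mg.
have [Nf|Nf] := ltP (N f) +oo%E; last first.
  move: Nf; rewrite leye_eq => /eqP ->.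
  by rewrite addye ?leey// gt_eqF// (lt_le_trans _ (luxemburg_norm_ge0 g)).
have [Ng|Ng] := ltP (N g) +oo%E; last first.
  move: Ng; rewrite leye_eq => /eqP ->.
  by rewrite addey ?leey// gt_eqF// (lt_le_trans _ (luxemburg_norm_ge0 f)).
have fNf := luxemburg_norm_fin Nf.
have fNg := luxemburg_norm_fin Ng.
apply/lee_addgt0Pr => e e0.
rewrite -(fineK fNf) -(fineK fNg) -!EFinD.
set a := fine (N f) + e / 2; set b := fine (N g) + e / 2.
have [a0 fa] : 0 < a /\ (rho (fun x => (f x / a)%R) <= 1)%E.
  by apply: luxemburg_norm_lt => //; rewrite -(fineK fNf) lte_fin /a; lra.
have [b0 gb] : 0 < b /\ (rho (fun x => (g x / b)%R) <= 1)%E.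
  by apply: luxemburg_norm_lt => //; rewrite -(fineK fNg) lte_fin /b; lra.
have ab0 : 0 < a + b by rewrite addr_gt0.
rewrite (_ : fine (N f) + fine (N g) + e = a + b); last by rewrite /a /b; field.
apply: luxemburg_norm_le => //.
rewrite (_ : (fun x => _) = (fun x => (a / (a + b) * (f x / a) +
    b / (a + b) * (g x / b))%R)); last first.
  by apply/funext => x /=; field; rewrite !gt_eqF.
apply: le_trans (modular_convex _ _ _ _ _) _.
- exact: measurable_funM.
- exact: measurable_funM.
- by rewrite divr_ge0 ?ltW.
- by rewrite divr_ge0 ?ltW.
- by rewrite -mulrDl divff// gt_eqF.
apply: (@le_trans _ _ ((a / (a + b))%:E * 1 + (b / (a + b))%:E * 1)%E).
  by apply: leeD; apply: lee_wpmul2l => //; rewrite lee_fin divr_ge0 ?ltW.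
by rewrite !mule1 -EFinD -mulrDl divff// gt_eqF.
Qed.

Lemma luxemburg_norm0 : N (fun=> 0) = 0%E.
Proof.
apply/eqP; rewrite eq_le luxemburg_norm_ge0 andbT.
apply/lee_addgt0Pr => e e0; rewrite add0e; apply: luxemburg_norm_le => //.
by under eq_fun do rewrite mul0r; rewrite modular0.
Qed.

Lemma luxemburg_normZ_le c f : measurable_fun setT f -> (N f < +oo)%E ->
  (N (fun x => (c * f x)%R) <= `|c|%:E * N f)%E.
Proof.
move=> mf Nf; have [->|c0] := eqVneq c 0.
  rewrite normr0 mul0e; under [X in luxemburg_norm _ _ X]eq_fun do rewrite mul0r.
  by rewrite luxemburg_norm0.
have fNf := luxemburg_norm_fin Nf.
have nc0 : 0 < `|c| by rewrite normr_gt0.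
apply/lee_addgt0Pr => e e0.
rewrite -(fineK fNf) -EFinM -EFinD; set a := fine (N f) + e / `|c|.
have [a0 fa] : 0 < a /\ (rho (fun x => (f x / a)%R) <= 1)%E.
  apply: luxemburg_norm_lt => //; rewrite -(fineK fNf) lte_fin /a ltrDl.
  exact: divr_gt0.
rewrite (_ : _ + e = `|c| * a); last first.
  by rewrite /a mulrDr mulrCA divff ?mulr1// gt_eqF.
apply: luxemburg_norm_le; first exact: mulr_gt0.
apply: le_trans fa; apply: le_modular.
- by apply: measurable_funM => //; exact: measurable_funM.
- exact: measurable_funM.
apply: nearW => x; rewrite !normrM !normfV normrM normr_id.
by rewrite invfM mulrACA divff ?gt_eqF// mul1r.
Qed.

Lemma luxemburg_normZ c f : measurable_fun setT f -> (N f < +oo)%E ->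
  N (fun x => (c * f x)%R) = (`|c|%:E * N f)%E.
Proof.
move=> mf Nf; apply/eqP; rewrite eq_le luxemburg_normZ_le//=.
have [->|c0] := eqVneq c 0.
  by rewrite normr0 mul0e luxemburg_norm_ge0.
have mcf : measurable_fun setT (fun x => c * f x) by exact: measurable_funM.
have Ncf : (N (fun x => (c * f x)%R) < +oo)%E.
  apply: le_lt_trans (luxemburg_normZ_le c mf Nf) _.
  by rewrite lte_mul_pinfty.
have := luxemburg_normZ_le c^-1 mcf Ncf.
rewrite (_ : (fun x => _) = f); last first.
  by apply/funext => x /=; rewrite mulrA mulVf// mul1r.
by rewrite normfV lee_pdivlMl ?normr_gt0.
Qed.

Lemma le_luxemburg_norm f g : measurable_fun setT f -> measurable_fun setT g ->
  (\forall x \ae mu, `|f x| <= `|g x|) -> (N f <= N g)%E.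
Proof.
move=> mf mg fg; rewrite [in leRHS]unlock; apply: le_ereal_inf_tmp => _ [l [l0 gl] <-].
apply: luxemburg_norm_le => //; apply: le_trans gl; apply: le_modular.
- exact: measurable_funM.
- exact: measurable_funM.
by apply: filterS fg => x fgx; rewrite !normrM ler_wpM2r.
Qed.

Lemma luxemburg_norm_ae f g : measurable_fun setT f -> measurable_fun setT g ->
  f = g %[ae mu] -> N f = N g.
Proof.
move=> mf mg fg; apply/eqP; rewrite eq_le; apply/andP; split;
  apply: le_luxemburg_norm => //; by apply: filterS fg => x /(_ I) ->.
Qed.

Lemma luxemburg_norm_eq0 f : measurable_fun setT f -> N f = 0%E ->
  f = (fun=> 0) %[ae mu].
Proof.
move=> mf Nf0.
have rf0 : rho f = 0%E.
  apply/eqP; rewrite eq_le modular_ge0 andbT; apply/lee_addgt0Pr => e e0.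
  rewrite add0e; set l := Num.min e 1.
  have l0 : 0 < l by rewrite lt_min e0 ltr01.
  have [_ fl] : 0 < l /\ (rho (fun x => (f x / l)%R) <= 1)%E.
    by apply: luxemburg_norm_lt => //; rewrite Nf0 lte_fin.
  apply: (@le_trans _ _ l%:E); last by rewrite lee_fin /l ge_min lexx.
  rewrite [X in rho X](_ : _ = (fun x => l * (f x / l) + (1 - l) * 0)); last first.
    by apply/funext => x; field; rewrite gt_eqF.
  apply: le_trans (modular_convex _ _ _ _ _) _ => //.
  - exact: measurable_funM.
  - exact: ltW.
  - by rewrite subr_ge0 /l ge_min lexx orbT.
  - by rewrite addrC subrK.
  rewrite modular0 mule0 adde0 -[leRHS]mule1.
  by apply: lee_wpmul2l => //; rewrite lee_fin ltW.
have : (\int[mu]_x `| (`|f x| `^ fine (p x))%:E | = 0)%E.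
  rewrite -[RHS]rf0 unlock; apply: eq_integral => x _.
  by rewrite gee0_abs// lee_fin powR_ge0.
move/(ae_eq_integral_abs mu measurableT (measurable_modular mf)).
apply: filterS => x /(_ I) /= [] /powR_eq0_eq0/eqP.
by rewrite normr_eq0 => /eqP.
Qed.

Section riesz_fischer.
Variable u : nat -> T -> R.
Hypothesis mu_ : forall n, measurable_fun [set: T] (u n).
Hypothesis Nu : forall n, (N (u n.+1 \- u n)%R < (2^-1 ^+ n)%:E)%E.

Let mdu m n : measurable_fun [set: T] (u m \- u n).
Proof. exact: measurable_funB. Qed.

Let norm_partial_sum (v : nat -> T -> R) n :
  (forall k, measurable_fun [set: T] (v k)) -> v 0%N = (fun=> 0) ->
  (forall k, \forall x \ae mu, `|v k.+1 x| <=
     `|v k x| + `|u (n + k).+1 x - u (n + k)%N x|) ->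
  forall k, (N (v k) <= (2 * 2^-1 ^+ n * (1 - 2^-1 ^+ k))%:E)%E.
Proof.
move=> mv v0 vS; elim=> [|k IH].
  by rewrite v0 luxemburg_norm0 expr0 subrr mulr0.
pose D y := `|u (n + k).+1 y - u (n + k)%N y|.
have mD : measurable_fun setT D by apply: measurableT_comp => //; exact: mdu.
have mnv : measurable_fun setT (fun x => `|v k x|) by exact: measurableT_comp.
apply: (@le_trans _ _ (N (v k) + (2^-1 ^+ (n + k))%:E)%E); last first.
  apply: le_trans (leeD2r _ IH) _.
  rewrite -EFinD lee_fin exprD exprS.
  by rewrite le_eqVlt; apply/orP; left; apply/eqP; field.
apply: (@le_trans _ _ (N ((fun x => `|v k x|) \+ D)%R)).
  apply: le_luxemburg_norm => //; first exact: measurable_funD.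
  by apply: filterS (vS k) => x /le_trans; apply; exact: ler_norm.
apply: le_trans (luxemburg_normD mnv mD) _; apply: leeD.
  by apply: le_luxemburg_norm => //; apply: nearW => x /=; rewrite normr_id.
apply: le_trans (ltW (Nu _)).
by apply: le_luxemburg_norm => //; apply: nearW => x /=; rewrite normr_id.
Qed.

Let S n x : R := \sum_(0 <= k < n) `|u k.+1 x - u k x|.

Let mS n : measurable_fun [set: T] (S n).
Proof.
by apply: measurable_sum => k; apply: measurableT_comp => //; exact: mdu.
Qed.

Let S_ge0 n x : 0 <= S n x.
Proof. exact: sumr_ge0. Qed.

Let modular_S n : (rho (fun x => (S n x / 3)%R) <= 1)%E.
Proof.
have NS : (N (S n) <= (2 * 2^-1 ^+ 0 * (1 - 2^-1 ^+ n))%:E)%E.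
  apply: (@norm_partial_sum S 0 mS) => [|k].
    by apply/funext => x; rewrite /S big_geq.
  apply: nearW => x; rewrite (ger0_norm (S_ge0 _ _)) (ger0_norm (S_ge0 _ _)).
  by rewrite /S big_nat_recr.
apply: (luxemburg_norm_lt (mS n) _).2; apply: le_lt_trans NS _.
have : 0 <= (2^-1 ^+ n : R) by rewrite exprn_ge0.
by rewrite lte_fin expr0; lra.
Qed.

Let exponent_ge0 x : 0 <= r x.
Proof. by apply: fine_ge0; apply: le_trans (hp.2 x). Qed.

Let ae_cvg_u : \forall x \ae mu, cvgn (u ^~ x).
Proof.
pose g n x : \bar R := (`|S n x / 3| `^ r x)%:E.
have mg n : measurable_fun [set: T] (g n).
  by apply: measurable_modular; exact: measurable_funM.
have g0 n x : (0 <= g n x)%E by rewrite lee_fin powR_ge0.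
have ndS x : nondecreasing_seq (S ^~ x).
  apply/nondecreasing_seqP => n.
  by rewrite /S big_nat_recr//= lerDl.
have ndg x : nondecreasing_seq (g ^~ x).
  move=> m n mn; rewrite lee_fin ge0_ler_powR ?nnegrE//.
  by rewrite !ger0_norm ?divr_ge0// ler_wpM2r//; exact: ndS.
have mlim : measurable_fun [set: T] (fun x => limn (g ^~ x)).
  apply: (emeasurable_fun_cvg g) => // x _.
  exact: ereal_nondecreasing_is_cvgn.
have lim0 x : (0 <= limn (g ^~ x))%E.
  by apply: lime_ge; [exact: ereal_nondecreasing_is_cvgn|exact: nearW].
have intlim : mu.-integrable [set: T] (fun x => limn (g ^~ x)).
  apply/integrableP; split => //.
  under eq_integral do rewrite gee0_abs//.
  rewrite monotone_convergence//.
  apply: le_lt_trans (ltry 1); apply: lime_le.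
    apply: ereal_nondecreasing_is_cvgn => m n mn.
    by apply: ge0_le_integral => // x _; exact: ndg.
  by apply: nearW => n; have := modular_S n; rewrite unlock.
apply: filterS2 exponent_ge1 (integrable_ae measurableT intlim) => x r1 /(_ I) fx.
pose C := fine (limn (g ^~ x)).
have SC n : S n x <= 3 * Num.max 1 C.
  have gC : (g n x <= C%:E)%E.
    rewrite fineK// (cvg_lim _ (ereal_nondecreasing_cvgn (ndg x)))//.
    by apply: ereal_sup_ubound; exists n.
  rewrite -ler_pdivrMl// mulrC le_max.
  have [//|S1] := leP (S n x / 3) 1.
  move: gC; rewrite lee_fin => /(le_trans _) -> //.
  by rewrite ger0_norm ?divr_ge0// le1r_powR// ltW.
have : cvgn (series (telescope (u ^~ x))).
  apply: normed_cvg; apply: nondecreasing_is_cvgn.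
    exact: (ndS x).
  by exists (3 * Num.max 1 C) => _ [n _ <-]; exact: SC.
move=> /(is_cvgD (is_cvg_cst (u 0%N x))).
rewrite [X in cvgn X](_ : _ = u ^~ x)//.
by apply/funext => n; rewrite (eq_sum_telescope (u ^~ x) n).
Qed.

Let limit x := fine (limn_esup (fun n => (u n x)%:E)).

Let measurable_limit : measurable_fun [set: T] limit.
Proof.
apply: measurableT_comp => //.
apply: (@measurable_fun_limn_esup _ _ _ _ (fun n x => (u n x)%:E)) => n.
exact/measurable_EFinP.
Qed.

Let ae_cvg_limit : \forall x \ae mu, u n x @[n --> \oo] --> limit x.
Proof.
apply: filterS ae_cvg_u => x ux.
have /cvg_limn_einf_sup[_] : (u n x)%:E @[n --> \oo] --> (limn (u ^~ x))%:E.
  by apply: cvg_EFin; [exact: nearW|exact: ux].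
by rewrite /limit => ->.
Qed.

Lemma riesz_fischer : exists2 f : T -> R, measurable_fun [set: T] f &
  forall n, (N (f \- u n)%R <= (2 * 2^-1 ^+ n)%:E)%E.
Proof.
exists limit => // n; pose l : R := 2 * 2^-1 ^+ n.
have l0 : 0 < l by rewrite mulr_gt0// exprn_gt0.
have rho_le1 m : (rho (fun x => ((u (n + m)%N \- u n) x / l)%R) <= 1)%E.
  apply: (luxemburg_norm_lt (mdu _ _) _).2.
  apply: (@le_lt_trans _ _ (2 * 2^-1 ^+ n * (1 - 2^-1 ^+ m))%:E).
    apply: (@norm_partial_sum (fun k => u (n + k)%N \- u n)) => [k||k].
    - exact: mdu.
    - by apply/funext => x; rewrite addn0 /= subrr.
    apply: nearW => x /=; rewrite addnS addrC -[X in X <= _]/(`|_|).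
    rewrite (le_trans _ (ler_normD _ _))// le_eqVlt; apply/orP; left; apply/eqP.
    by congr `|_|; ring.
  by rewrite lte_fin gtr_pMr// ltrBlDr ltrDl exprn_gt0.
apply: luxemburg_norm_le => //.
pose h m x : \bar R := (`|(u (n + m)%N \- u n) x / l| `^ r x)%:E.
have mh m : measurable_fun [set: T] (h m).
  by apply: measurable_modular; apply: measurable_funM => //; exact: mdu.
have h0 m x : [set: T] x -> (0 <= h m x)%E by rewrite lee_fin powR_ge0.
apply: (@le_trans _ _ (\int[mu]_x limn_einf (h ^~ x))%E); last first.
  apply: le_trans (fatou mu measurableT mh h0) _.
  rewrite limn_einf_lim; apply: lime_le; first exact: is_cvg_einfs.
  apply: nearW => k; apply: (@le_trans _ _ (\int[mu]_x h k x)%E).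
    by apply: ereal_inf_lbound; exists k => //=.
  by have := rho_le1 k; rewrite unlock.
rewrite unlock; apply: ae_ge0_le_integral => //.
- apply: measurable_modular; apply: measurable_funM => //.
  exact: measurable_funB.
- move=> x _; rewrite limn_einf_lim; apply: lime_ge; first exact: is_cvg_einfs.
  by apply: nearW => k; apply: le_ereal_inf_tmp => _ [m _ <-]; exact: h0.
- rewrite /limn_einf; apply: measurableT_comp => //.
  apply: (@measurable_fun_limn_esup _ _ _ _ (fun m x => (- h m x)%E)) => m.
  exact: measurableT_comp.
apply: filterS2 exponent_ge1 ae_cvg_limit => x r1 ux _.
have uxn : u (n + m)%N x @[m --> \oo] --> limit x.
  rewrite (_ : (fun m => _) = [sequence u (m + n)%N x]_m); last first.
    by apply/funext => m; rewrite addnC.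
  by move: ux; rewrite -(cvg_shiftn n).
have cvgc : `|(u (n + m)%N \- u n) x / l| @[m --> \oo] --> `|(limit \- u n) x / l|.
  apply: cvg_norm; apply: cvgMl; apply: cvgB; last exact: cvg_cst.
  by [].
have [->|c0] := eqVneq `|(limit \- u n) x / l| 0.
  rewrite powR0 ?gt_eqF ?(lt_le_trans ltr01)// limn_einf_lim.
  apply: lime_ge; first exact: is_cvg_einfs.
  by apply: nearW => k; apply: le_ereal_inf_tmp => _ [m _ <-]; exact: h0.
have cpos : 0 < `|(limit \- u n) x / l| by rewrite lt_neqAle eq_sym c0 normr_ge0.
suff /cvg_limn_einf_sup[-> _] :
  h m x @[m --> \oo] --> (`|(limit \- u n) x / l| `^ r x)%:E by [].
apply/cvg_EFin; first exact: nearW.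
apply: (@cvg_comp _ _ _ _ (fun y => y `^ r x) _ _ _ cvgc).
have := @differentiable_continuous _ _ _ `|(limit \- u n) x / l| (fun y => y `^ r x).
apply; apply/derivable1_diffP.
by apply: derivable_powR; rewrite in_itv/= cpos.
Qed.

End riesz_fischer.

End luxemburg_theory.

Section variable_lebesgue_space.
Context d (T : measurableType d) (R : realType).
Variables (mu : {measure set T -> \bar R}) (p : T -> \bar R).

Definition vLfun_pred : {pred T -> R} :=
  mem [set f | measurable_fun [set: T] f /\ (luxemburg_norm mu p f < +oo)%E].

(* [hp] and [pb] are recorded as parameters because the vector space structure
   depends on them, as with [LfunType mu p1] in [hoelder]. *)
Record vLfun (hp : variable_exponent p) (pb : (ess_sup mu p < +oo)%E) :=
  VLfun { vLfun_val :> T -> R ; _ : vLfun_val \in vLfun_pred }.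

Variables (hp : variable_exponent p) (pb : (ess_sup mu p < +oo)%E).
Local Notation N := (luxemburg_norm mu p).
Local Notation V := (vLfun hp pb).

HB.instance Definition _ := [isSub of V for @vLfun_val hp pb].
HB.instance Definition _ := [Choice of V by <:].

Lemma vLfun_predP f :
  reflect (measurable_fun [set: T] f /\ (N f < +oo)%E) (f \in vLfun_pred).
Proof. by apply: (iffP idP) => [/set_mem//|?]; exact/mem_set. Qed.

Lemma vLfun_submod_closed : submod_closed vLfun_pred.
Proof.
split.
  apply/vLfun_predP; split; first exact: measurable_cst.
  by rewrite (luxemburg_norm0 hp pb : N 0 = 0%E).
move=> a f g /vLfun_predP[mf Nf] /vLfun_predP[mg Ng]; apply/vLfun_predP.
have maf : measurable_fun [set: T] (fun x => a * f x) by exact: measurable_funM.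
split; first exact: measurable_funD.
apply: le_lt_trans (luxemburg_normD hp pb maf mg) _.
by rewrite lte_add_pinfty// (luxemburg_normZ hp pb)// lte_mul_pinfty.
Qed.

HB.instance Definition _ :=
  GRing.isSubmodClosed.Build _ _ vLfun_pred vLfun_submod_closed.
HB.instance Definition _ := [SubChoice_isSubLmodule of V by <:].

Lemma vLfun_measurable (f : V) : measurable_fun [set: T] f.
Proof. by have /vLfun_predP[] := valP f. Qed.

Lemma vLfun_norm_lty (f : V) : (N f < +oo)%E.
Proof. by have /vLfun_predP[] := valP f. Qed.

Definition vLfun_ae_eq (f g : V) := `[< f = g %[ae mu] >].

Let vLfun_ae_eq_refl : reflexive vLfun_ae_eq.
Proof. by move=> f; apply/asboolP; exact: ae_eq_refl. Qed.

Let vLfun_ae_eq_sym : symmetric vLfun_ae_eq.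
Proof. by move=> f g; apply/idP/idP => /asboolP h; apply/asboolP/ae_eq_sym. Qed.

Let vLfun_ae_eq_trans : transitive vLfun_ae_eq.
Proof.
by move=> f g h /asboolP gf /asboolP fh; apply/asboolP/(ae_eq_trans gf fh).
Qed.

Canonical vLfun_ae_eq_canonical :=
  EquivRel vLfun_ae_eq vLfun_ae_eq_refl vLfun_ae_eq_sym vLfun_ae_eq_trans.

Local Open Scope quotient_scope.

Definition vLspace : Type := {eq_quot vLfun_ae_eq}.
HB.instance Definition _ := Choice.on vLspace.
HB.instance Definition _ := EqQuotient.on vLspace.

Lemma vLspaceP (f g : V) :
  reflect (f = g %[ae mu]) (f == g %[mod vLspace]).
Proof. by apply/(iffP idP); rewrite eqmodE// => /asboolP. Qed.

Lemma repr_vLspace (f : V) : repr (\pi_vLspace f) = f %[ae mu].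
Proof. by apply/vLspaceP; rewrite reprK. Qed.

Definition vL_zero : vLspace := lift_cst vLspace 0.
Definition vL_opp := lift_op1 vLspace -%R.
Definition vL_add := lift_op2 vLspace +%R.
Definition vL_scale a := lift_op1 vLspace ( *:%R a).
Canonical pi_vL_zero_morph := PiConst vL_zero.

Lemma pi_vL_opp : {morph \pi_vLspace : f / - f >-> vL_opp f}.
Proof.
move=> f; unlock vL_opp; apply/eqP/vLspaceP.
apply: filterS (repr_vLspace f) => x /[apply] fx.
by rewrite -[LHS]/(- (f x)) -fx.
Qed.
Canonical pi_vL_opp_morph := PiMorph1 pi_vL_opp.

Lemma pi_vL_add : {morph \pi_vLspace : f g / f + g >-> vL_add f g}.
Proof.
move=> f g; unlock vL_add; apply/eqP/vLspaceP.
apply: filterS2 (repr_vLspace f) (repr_vLspace g) => x fx gx /[dup] /fx + /gx.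
by move=> {}fx {}gx; rewrite -[LHS]/(f x + g x) -fx -gx.
Qed.
Canonical pi_vL_add_morph := PiMorph2 pi_vL_add.

Lemma pi_vL_scale a : {morph \pi_vLspace : f / a *: f >-> vL_scale a f}.
Proof.
move=> f; unlock vL_scale; apply/eqP/vLspaceP.
apply: filterS (repr_vLspace f) => x /[apply] fx.
by rewrite -[LHS]/(a * f x) -fx.
Qed.
Canonical pi_vL_scale_morph a := PiMorph1 (pi_vL_scale a).

Let vL_addA : associative vL_add.
Proof. by move=> f g h; rewrite -[f]reprK -[g]reprK -[h]reprK !piE addrA. Qed.

Let vL_addC : commutative vL_add.
Proof. by move=> f g; rewrite -[f]reprK -[g]reprK !piE addrC. Qed.

Let vL_add0 : left_id vL_zero vL_add.
Proof. by move=> f; rewrite -[f]reprK !piE add0r. Qed.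

Let vL_addN : left_inverse vL_zero vL_opp vL_add.
Proof. by move=> f; rewrite -[f]reprK !piE addNr. Qed.

HB.instance Definition _ :=
  GRing.isZmodule.Build vLspace vL_addA vL_addC vL_add0 vL_addN.

Let vL_scaleA a b f : vL_scale a (vL_scale b f) = vL_scale (a * b) f.
Proof. by rewrite -[f]reprK !piE scalerA. Qed.

Let vL_scale1 : left_id 1 vL_scale.
Proof. by move=> f; rewrite -[f]reprK !piE scale1r. Qed.

Let vL_scaleDr : right_distributive vL_scale +%R.
Proof. by move=> a f g; rewrite -[f]reprK -[g]reprK !piE scalerDr. Qed.

Let vL_scaleDl f : {morph vL_scale^~ f : a b / a + b}.
Proof. by move=> a b; rewrite -[f]reprK !piE scalerDl. Qed.

HB.instance Definition _ := GRing.Zmodule_isLmodule.Build R vLspace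
  vL_scaleA vL_scale1 vL_scaleDr vL_scaleDl.

Definition vL_norm (f : vLspace) : R := fine (N (repr f)).

Lemma vL_norm_pi (f : V) : (vL_norm (\pi_vLspace f))%:E = N f.
Proof.
rewrite /vL_norm fineK ?luxemburg_norm_fin ?vLfun_norm_lty//.
apply: (luxemburg_norm_ae hp pb); try exact: vLfun_measurable.
exact: repr_vLspace.
Qed.

Lemma pi_vLspaceD : {morph \pi_vLspace : f g / f + g >-> f + g}.
Proof. exact: pi_vL_add. Qed.

Lemma pi_vLspaceN : {morph \pi_vLspace : f / - f >-> - f}.
Proof. exact: pi_vL_opp. Qed.

Lemma pi_vLspaceZ a : {morph \pi_vLspace : f / a *: f >-> a *: f}.
Proof. exact: pi_vL_scale. Qed.

Let vL_normD f g : vL_norm (f + g) <= vL_norm f + vL_norm g.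
Proof.
rewrite -[f]reprK -[g]reprK -lee_fin EFinD -pi_vLspaceD !vL_norm_pi.
exact: luxemburg_normD (vLfun_measurable _) (vLfun_measurable _).
Qed.

Let vL_normZ a f : vL_norm (a *: f) = `|a| * vL_norm f.
Proof.
apply: EFin_inj; rewrite -[f]reprK EFinM -pi_vLspaceZ !vL_norm_pi.
exact: luxemburg_normZ (vLfun_measurable _) (vLfun_norm_lty _).
Qed.

Let vL_norm_eq0 f : vL_norm f = 0 -> f = 0.
Proof.
move=> f0; have := congr1 EFin f0; rewrite -[f]reprK vL_norm_pi => Nf.
rewrite -[0]/vL_zero piE; apply/eqP/vLspaceP.
exact: luxemburg_norm_eq0 (vLfun_measurable _) Nf.
Qed.

HB.instance Definition _ :=
  Lmodule_isNormed.Build R vLspace vL_normD vL_normZ vL_norm_eq0.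

Let vL_norm_repr (f g : vLspace) :
  `|f - g|%:E = N ((repr f : T -> R) \- (repr g : T -> R)).
Proof.
rewrite -[f in LHS]reprK -[g in LHS]reprK -pi_vLspaceN -pi_vLspaceD.
exact: vL_norm_pi.
Qed.

Let vL_complete (F : set_system vLspace) : ProperFilter F -> cauchy F -> cvg F.
Proof.
move=> FF /cauchyP Fc.
have e0 n : 0 < (2^-1 ^+ n.+1 : R) by rewrite exprn_gt0.
have /choice[x Fx] n : exists x, F (ball x (2^-1 ^+ n.+1)) by exact: Fc.
pose u n : T -> R := repr (x n).
have mu_ n : measurable_fun [set: T] (u n) by exact: vLfun_measurable.
have Nu n : (N (u n.+1 \- u n)%R < (2^-1 ^+ n)%:E)%E.
  rewrite -vL_norm_repr lte_fin.
  have [z [xz xz']] := filter_ex (filterI (Fx n) (Fx n.+1)).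
  rewrite -ball_normE /= in xz xz'.
  rewrite (le_lt_trans (ler_distD z _ _))//.
  rewrite (lt_le_trans (ltrD xz' (_ : `|z - x n| < 2^-1 ^+ n.+1)))//.
    by rewrite distrC.
  by move: (e0 n); rewrite !exprS; lra.
have [f mf fu] := riesz_fischer hp pb mu_ Nu.
have fP : f \in vLfun_pred.
  apply/vLfun_predP; split => //.
  rewrite (_ : f = (f \- u 0%N) \+ u 0%N); last first.
    by apply/funext => t /=; rewrite subrK.
  have mfu : measurable_fun setT (f \- u 0%N) by exact: measurable_funB.
  apply: le_lt_trans (luxemburg_normD hp pb mfu (mu_ 0%N)) _.
  by rewrite lte_add_pinfty ?vLfun_norm_lty// (le_lt_trans (fu 0%N)) ?ltry.
pose g : vLspace := \pi_vLspace (VLfun hp pb fP).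
have gx n : `|g - x n| <= 2 * 2^-1 ^+ n.
  rewrite -lee_fin vL_norm_repr; apply: le_trans (fu n).
  rewrite le_eqVlt; apply/orP; left; apply/eqP.
  apply: (luxemburg_norm_ae hp pb).
  - by apply: measurable_funB => //; exact: vLfun_measurable.
  - exact: measurable_funB.
  by apply: filterS (repr_vLspace (VLfun hp pb fP)) => t /[apply] /= ->.
apply/cvg_ex; exists g; apply/cvgrPdist_lt => e egt0 /=.
have [n ne] : exists n, 3 * 2^-1 ^+ n < e.
  have half : `|2^-1| < 1 :> R by rewrite ger0_norm// invf_lt1// ltr1n.
  have /cvgrPdist_lt/(_ _ egt0)[n _ ne] := cvg_geometric 3 half.
  exists n; move: (ne n (leqnn n)); rewrite /= sub0r normrN ger0_norm//.
apply: filterS (Fx n) => z; rewrite -ball_normE /= => xz.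
rewrite (le_lt_trans (ler_distD (x n) _ _))// (le_lt_trans _ ne)//.
rewrite (le_trans (lerD (gx n) (ltW xz)))// exprS.
have := e0 n; rewrite exprS; lra.
Qed.

HB.instance Definition _ := Uniform_isComplete.Build vLspace vL_complete.

End variable_lebesgue_space.

Section bounded_approximation.
Variable R : realType.

Definition finite_rank (V : normedModType R) (F : V -> V) : Prop :=
  exists n (e : 'I_n -> V), forall x,
    exists c : 'I_n -> R, F x = \sum_(i < n) c i *: e i.

Definition operator_norm (V : normedModType R) (F : V -> V) : \bar R :=
  ereal_sup [set `|F x|%:E | x in [set x : V | `|x| <= 1]].

Definition bounded_approximation_property (V : completeNormedModType R) : Prop :=
  exists2 M : R, 0 < M &
    forall K : set V, compact K -> forall e : R, 0 < e ->
      exists F : {linear V -> V},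
        [/\ bounded_fun_norm F, finite_rank F, (operator_norm F <= M%:E)%E &
            forall x, K x -> `|x - F x| < e].

End bounded_approximation.

(* Main.v *)
From HB Require Import structures.
Require Import Defs.
From mathcomp Require Import all_boot all_order all_algebra finmap.
From mathcomp Require Import all_classical all_reals all_analysis.
From mathcomp Require Import measurable_realfun ess_sup_inf.
From mathcomp Require Import ring lra.

Set Implicit Arguments.
Unset Strict Implicit.
Unset Printing Implicit Defensive.
Import Order.TTheory GRing.Theory Num.Theory.
Import numFieldNormedType.Exports.

Local Open Scope classical_set_scope.
Local Open Scope ring_scope.

(** Bounded approximation holds because the space is approximated by averaging
    (conditional expectation) operators.  For finitely many disjoint cells [A_j]
    of finite positive measure let [F f] be the mean of [f] over [A_j] on each
    [A_j], and [0] elsewhere: this has finite rank.  If the given functions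
    oscillate little on every cell and the cells miss little of the space, then
    [F] moves these functions little.  A compact set lies close to a finite set,
    so the whole difficulty is a bound on [F] that does not depend on the cells.

    With a variable exponent [r], averaging is not bounded uniformly over all
    partitions; it is on cells where [r] is almost constant compared with the
    logarithm of the measure of the cell.  Precisely, let [1 <= r <= P], let [r]
    oscillate by at most [delta] on every cell, and let [L] bound the total
    measure of the cells and one plus the inverse of the measure of each cell.
    Suppose that [f] has modular at most [1], and let [b] be the mean of [|f|]
    on a cell.  If [b <= 1/L] then [b ^ r <= 1/L], and all the cells together
    contribute at most [1] to the modular of [F f].  Otherwise [b] lies between
    [1/L] and [L], so that changing the exponent of [b] by [delta] costs at most
    a factor [L ^ delta], and a Jensen-type inequality with constant [2 ^ P]
    compares [b ^ r] with the mean of [|f| ^ r].  Hence the modular of [F f] is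
    at most [1 + 2 ^ P * L ^ delta] ([powR_mean_le], [modular_averaging]).

    It remains to choose cells for which [L ^ delta] is bounded a priori
    ([exists_admissible_cells]).  Slicing the range of [r] into [n] levels gives
    [delta = P / n] and multiplies the number of cells only by about [n].
    Discard the cells whose measure is below a fixed multiple of [1 / n]: their
    union is small, and for the others [L <= n ^ 2] as soon as [n] is large.
    Then [L ^ delta <= (n ^ 2) ^ (P / n) <= exp (2 * P)], and the bound
    [2 * (1 + 2 ^ P * exp (2 * P))] for the operator norms depends on [P] only. *)

(** * Two inequalities on real powers *)

Section powers.
Variable R : realType.
Implicit Types t s b e : R.

(** A substitute for Jensen's inequality: applied to [t = |f| / b] with [b] the
    mean of [|f|], the term [2^-1] absorbs half of the mean of [t], which is [1].
    The constant is uniform in [s], so [s] may vary from point to point. *)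
Lemma ler_half_powR (P t s : R) : 0 <= t -> 1 <= s <= P ->
  t <= 2^-1 + 2 `^ P / 2 * t `^ s.
Proof.
move=> t0 /andP[s1 sP]; have [th|th] := leP t 2^-1.
  by apply: (le_trans th); rewrite lerDl mulr_ge0 ?divr_ge0 ?powR_ge0.
have : 2 * t <= 2 `^ P * t `^ s.
  apply: (@le_trans _ _ ((2 * t) `^ s)); first by apply: le1r_powR => //; lra.
  by rewrite powRM// ler_wpM2r ?powR_ge0// ler_powR// ler1n.
by lra.
Qed.

Lemma powR_le_small_exponent (L e b s : R) : 0 < L -> L^-1 <= b <= L ->
  `|s| <= e -> b `^ s <= L `^ e.
Proof.
move=> L0 /andP[Lb bL] se.
have b0 : 0 < b by apply: lt_le_trans Lb; rewrite invr_gt0.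
rewrite /powR !gt_eqF// ler_expR.
have lnb : `|ln b| <= ln L.
  rewrite ler_norml -lnV ?posrE// !ler_ln ?posrE ?invr_gt0//.
  by rewrite Lb bL.
apply: le_trans (ler_norm _) _; rewrite normrM.
by apply: ler_pM.
Qed.

End powers.

(** * Means over a set of finite positive measure *)

Section mean.
Context d (T : measurableType d) (R : realType).
Variables (mu : {measure set T -> \bar R}) (A : set T).
Hypotheses (mA : measurable A) (A0 : (0 < mu A)%E) (Aoo : (mu A < +oo)%E).
Implicit Types f g : T -> R.

Definition mean f : R := (fine (mu A))^-1 * Rintegral mu A f.

Lemma fine_measure_gt0 : 0 < fine (mu A).
Proof. by rewrite fine_gt0// A0. Qed.

Local Notation integrable f := (mu.-integrable A (EFin \o f)).

Lemma mean_cst (c : R) : mean (cst c) = c.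
Proof.
by rewrite /mean Rintegral_cst// mulrCA mulVf ?mulr1// gt_eqF// fine_measure_gt0.
Qed.

Lemma integrable_cst (c : R) : integrable (cst c).
Proof.
apply/integrableP; split; first by apply/measurable_EFinP; exact: measurable_cst.
rewrite (eq_integral (cst `|c|%:E)) => [|x _] //.
by rewrite integral_cst// lte_mul_pinfty.
Qed.

Lemma integrable_addr f g : integrable f -> integrable g ->
  integrable (fun x => f x + g x).
Proof.
by move=> fi gi; apply: eq_integrable (integrableD mA fi gi) => // x _.
Qed.

Lemma integrable_mull (c : R) f : integrable f -> integrable (fun x => c * f x).
Proof. by move=> fi; apply: eq_integrable (integrableZl mA c fi) => // x _. Qed.

Lemma meanD f g : integrable f -> integrable g ->
  mean (fun x => f x + g x) = mean f + mean g.
Proof. by move=> fi gi; rewrite /mean RintegralD// mulrDr. Qed.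

Lemma meanB f g : integrable f -> integrable g ->
  mean (fun x => f x - g x) = mean f - mean g.
Proof. by move=> fi gi; rewrite /mean RintegralB// mulrBr. Qed.

Lemma meanZ (c : R) f : integrable f -> mean (fun x => c * f x) = c * mean f.
Proof. by move=> fi; rewrite /mean RintegralZl// mulrCA. Qed.

Lemma le_mean f g : integrable f -> integrable g ->
  (forall x, A x -> f x <= g x) -> mean f <= mean g.
Proof.
move=> fi gi fg; rewrite /mean ler_wpM2l ?invr_ge0 ?(ltW fine_measure_gt0)//.
exact: le_Rintegral.
Qed.

Lemma le_norm_mean f : integrable f -> `|mean f| <= mean (fun x => `|f x|).
Proof.
move=> fi; rewrite /mean normrM gtr0_norm ?invr_gt0 ?fine_measure_gt0//.
rewrite ler_wpM2l ?invr_ge0 ?(ltW fine_measure_gt0)//.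
exact: le_normr_Rintegral.
Qed.

Lemma mean_ge0 f : (forall x, A x -> 0 <= f x) -> 0 <= mean f.
Proof.
by move=> f0; rewrite mulr_ge0 ?invr_ge0 ?(ltW fine_measure_gt0)// Rintegral_ge0.
Qed.

End mean.

(** * The mean over a single cell *)

Section cell_mean.
Context d (T : measurableType d) (R : realType).
Variables (mu : {measure set T -> \bar R}) (p : T -> \bar R).
Hypothesis hp : variable_exponent p.
Local Notation r := (fun x => fine (p x)).
Variables (A : set T) (P delta L : R).
Hypotheses (mA : measurable A) (A0 : (0 < mu A)%E) (Aoo : (mu A < +oo)%E).
Hypothesis rP : forall x, A x -> 1 <= r x <= P.
Hypothesis r_osc : forall x y, A x -> A y -> `|r x - r y| <= delta.
Variable f : T -> R.
Hypotheses (mf : measurable_fun [set: T] f).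
Hypothesis fA : (\int[mu]_(x in A) (`|f x| `^ r x)%:E < +oo)%E.
Local Notation integrable g := (mu.-integrable A (EFin \o g)).
Local Notation mean := (mean mu A).

Lemma integrable_modular_cell : integrable (fun x => `|f x| `^ r x).
Proof.
apply/integrableP; split.
  exact: measurable_funS (measurable_modular hp mf).
rewrite (eq_integral (fun x => (`|f x| `^ r x)%:E)) => [|x _] //=.
by rewrite ger0_norm// powR_ge0.
Qed.

Lemma norm_le_1D_modular x : A x -> `|f x| <= 1 + `|f x| `^ r x.
Proof.
move=> Ax; have [f1|f1] := leP `|f x| 1.
  by apply: (le_trans f1); rewrite lerDl powR_ge0.
have /andP[r1 _] := rP Ax.
by apply: (le_trans (le1r_powR (ltW f1) r1)); rewrite lerDr.
Qed.

Lemma integrable_1D_modular : integrable (fun x => 1 + `|f x| `^ r x).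
Proof.
by apply: integrable_addr integrable_modular_cell => //; exact: integrable_cst.
Qed.

Lemma integrable_cell : integrable f.
Proof.
apply: (le_integrable mA _ _ integrable_1D_modular).
  by apply/measurable_EFinP; exact: measurable_funS mf.
move=> x Ax /=; rewrite lee_fin [leRHS]ger0_norm ?addr_ge0 ?powR_ge0//.
exact: norm_le_1D_modular.
Qed.

(** The term [L^-1] takes care of the means below [L^-1], for which lowering the
    exponent cannot be controlled; above this threshold the values of the mean
    raised to two exponents of the cell differ by a factor [L `^ delta]. *)
Lemma powR_mean_le y : A y -> 1 + mean (fun x => `|f x| `^ r x) <= L ->
  `|mean f| `^ r y <=
    L^-1 + 2 `^ P * L `^ delta * mean (fun x => `|f x| `^ r x).
Proof.
move=> Ay mL; set I := mean _ in mL *.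
have If := integrable_cell; have Im := integrable_modular_cell.
have In : integrable (fun x => `|f x|) by exact: integrable_norm.
have I0 : 0 <= I by apply: mean_ge0 => // x _; exact: powR_ge0.
have L1 : 1 <= L by apply: le_trans mL; rewrite lerDl.
have L0 : 0 < L := lt_le_trans ltr01 L1.
have /andP[ry1 ryP] := rP Ay.
have ry0 : 0 <= r y by exact: le_trans ry1.
set b := mean (fun x => `|f x|).
have fb : `|mean f| <= b by exact: le_norm_mean.
have b0 : 0 <= b by exact: le_trans fb.
apply: (@le_trans _ _ (b `^ r y)); first by rewrite ge0_ler_powR ?nnegrE.
have [bL|Lb] := leP b L^-1.
  rewrite (@le_trans _ _ b)//; last first.
    by apply: (le_trans bL); rewrite lerDl mulr_ge0// mulr_ge0 ?powR_ge0.
  have [->|bN0] := eqVneq b 0; first by rewrite powR0// gt_eqF// (lt_le_trans ltr01).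
  rewrite ge1r_powR// lt_neqAle eq_sym bN0 b0/=.
  by rewrite (le_trans bL)// invf_le1.
have bgt0 : 0 < b by apply: lt_trans Lb; rewrite invr_gt0.
have bleL : b <= L.
  apply: le_trans mL; rewrite -[in leRHS](mean_cst mA A0 Aoo 1) -meanD//.
    by apply: le_mean => //; [exact: integrable_1D_modular|exact: norm_le_1D_modular].
  exact: integrable_cst.
(* [ler_half_powR] is averaged over the cell after multiplication by
   [b `^ r y]; half of the left-hand side is then absorbed. *)
pose K := 2 `^ P / 2 * L `^ delta.
suff : b `^ r y <= 2^-1 * b `^ r y + K * I.
  rewrite /K => h.
  have : 0 < L^-1 by rewrite invr_gt0.
  lra.
rewrite -[in leLHS]mulr_powRB1//; last exact: lt_le_trans ry1.
rewrite mulrC -meanZ//.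
rewrite -[X in _ <= X + _](mean_cst mA A0 Aoo) -meanZ// -meanD//; first last.
- exact: integrable_mull.
- exact: integrable_cst.
apply: le_mean => //.
- exact: integrable_mull.
- apply: integrable_addr => //; first exact: integrable_cst.
  exact: integrable_mull.
move=> x Ax; have rxP := rP Ax.
have /andP[rx1 _] := rxP.
have := @ler_half_powR _ P (`|f x| / b) (r x) _ rxP.
rewrite divr_ge0// => /(_ isT) h.
have -> : b `^ (r y - 1) * `|f x| = b `^ r y * (`|f x| / b).
  rewrite -[in RHS](@mulr_powRB1 _ b)//; last exact: lt_le_trans ry1.
  by field; rewrite gt_eqF.
apply: (le_trans (ler_wpM2l (powR_ge0 _ _) h)).
rewrite mulrDr mulrC /cst lerD2l /K.
have -> : b `^ r y * (2 `^ P / 2 * (`|f x| / b) `^ r x) =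
    2 `^ P / 2 * (b `^ (r y - r x) * `|f x| `^ r x).
  rewrite (powRM _ (normr_ge0 (f x))) ?invr_ge0// powRB ?(gt_eqF bgt0) ?implybT//.
  rewrite -(powR_inv1 b0) -powRrM mulN1r powRN.
  by ring.
rewrite -[leRHS]mulrA ler_wpM2l ?divr_ge0 ?powR_ge0// ler_wpM2r ?powR_ge0//.
apply: powR_le_small_exponent => //; last exact: r_osc.
by rewrite (ltW Lb).
Qed.

End cell_mean.

(** * Averaging over a family of cells *)

Section modular_scaling.
Context d (T : measurableType d) (R : realType).
Variables (mu : {measure set T -> \bar R}) (p : T -> \bar R).
Hypotheses (hp : variable_exponent p) (pb : (ess_sup mu p < +oo)%E).
Local Notation rho := (modular mu p).
Local Notation N := (luxemburg_norm mu p).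

(** By convexity and the vanishing of the modular at [0]; this turns a bound on
    modulars into a bound on norms with the same constant. *)
Lemma modular_div_le1 (g : T -> R) (M : R) : measurable_fun [set: T] g ->
  1 <= M -> (rho g <= M%:E)%E -> (rho (fun x => (g x / M)%R) <= 1)%E.
Proof.
move=> mg M1 gM; have M0 : 0 < M by exact: lt_le_trans M1.
rewrite (_ : (fun x => _) = (fun x => M^-1 * g x + (1 - M^-1) * 0)); last first.
  by apply/funext => x; rewrite mulr0 addr0 mulrC.
apply: le_trans (modular_convex hp pb _ _ _ _ _) _ => //.
- by rewrite invr_ge0 ltW.
- by rewrite subr_ge0 invf_le1.
- by rewrite addrC subrK.
rewrite (modular0 hp pb) mule0 adde0.
apply: (@le_trans _ _ (M^-1%:E * M%:E)%E).
  by rewrite lee_wpmul2l// lee_fin invr_ge0 ltW.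
by rewrite -EFinM mulVf// gt_eqF.
Qed.

Lemma luxemburg_norm_le_modular (g : T -> R) (M : R) :
  measurable_fun [set: T] g -> 1 <= M -> (rho g <= M%:E)%E -> (N g <= M%:E)%E.
Proof.
move=> mg M1 gM; apply: luxemburg_norm_le; first exact: lt_le_trans M1.
exact: modular_div_le1.
Qed.

End modular_scaling.

Section averaging.
Context d (T : measurableType d) (R : realType).
Variables (mu : {measure set T -> \bar R}) (p : T -> \bar R).
Hypotheses (hp : variable_exponent p) (pb : (ess_sup mu p < +oo)%E).
Local Notation r := (fun x => fine (p x)).
Local Notation rho := (modular mu p).
Local Notation N := (luxemburg_norm mu p).
Variables (J : finType) (A : J -> set T) (P delta L : R).
Hypotheses (mA : forall j, measurable (A j)) (tA : trivIset [set: J] A).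
Hypotheses (A0 : forall j, (0 < mu (A j))%E) (Aoo : forall j, (mu (A j) < +oo)%E).
Hypothesis rP : forall j x, A j x -> 1 <= r x <= P.

Implicit Type f : T -> R.

Definition averaging (f : T -> R) (x : T) : R :=
  \sum_j mean mu (A j) f * \1_(A j) x.

Lemma averaging_cell f j x : A j x -> averaging f x = mean mu (A j) f.
Proof.
move=> Ajx; rewrite /averaging (bigD1 j)//= indicE mem_set// mulr1.
rewrite big1 ?addr0// => i ij; rewrite indicE memNset ?mulr0// => Aix.
by move/eqP: ij; apply; apply: (tA I I); exists x.
Qed.

Lemma averaging_out f x : (forall j, ~ A j x) -> averaging f x = 0.
Proof.
by move=> xA; rewrite /averaging big1// => j _; rewrite indicE memNset ?mulr0.
Qed.

Lemma measurable_averaging f : measurable_fun [set: T] (averaging f).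
Proof.
by apply: measurable_sum => j; apply: measurable_funM.
Qed.

Lemma integral_cell_le f j : measurable_fun [set: T] f ->
  (\int[mu]_(x in A j) (`|f x| `^ r x)%:E <= rho f)%E.
Proof.
move=> mf; rewrite unlock; apply: ge0_subset_integral => //.
exact: measurable_modular.
Qed.

Lemma sum_integral_cell_le f : measurable_fun [set: T] f ->
  (\sum_j \int[mu]_(x in A j) (`|f x| `^ r x)%:E <= rho f)%E.
Proof.
move=> mf; rewrite -ge0_integral_bigsetU//; first last.
- by apply: measurable_funS (measurable_modular hp mf).
- exact: sub_trivIset tA.
- exact: index_enum_uniq.
rewrite [in leRHS]unlock; apply: ge0_subset_integral => //.
- exact: bigsetU_measurable.
- exact: measurable_modular.
Qed.

Lemma integrable_of_luxemburg_norm f j : measurable_fun [set: T] f ->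
  (N f < +oo)%E -> mu.-integrable (A j) (EFin \o f).
Proof.
move=> mf Nf; pose l := fine (N f) + 1.
have [l0 fl] : 0 < l /\ (rho (fun x => (f x / l)%R) <= 1)%E.
  apply: (luxemburg_norm_lt hp pb) => //.
  by rewrite -(fineK (luxemburg_norm_fin Nf)) lte_fin ltrDl.
have mfl : measurable_fun [set: T] (fun x => f x / l) by exact: measurable_funM.
rewrite (_ : EFin \o f = EFin \o (fun x => l * (f x / l))); last first.
  by apply/funext => x /=; congr EFin; field; rewrite gt_eqF.
apply: integrable_mull => //.
apply: (integrable_cell hp (mA j) (Aoo j) (@rP j)) => //.
apply: le_lt_trans (integral_cell_le _ mfl) _.
exact: le_lt_trans fl (ltry 1).
Qed.

Hypothesis r_osc : forall j x y, A j x -> A j y -> `|r x - r y| <= delta.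
Hypothesis AL : (\sum_j mu (A j) <= L%:E)%E.
Hypothesis A_ge : forall j, 1 + (fine (mu (A j)))^-1 <= L.
Hypothesis L0 : 0 < L.

Let M : R := 1 + 2 `^ P * L `^ delta.

Let M1 : 1 <= M.
Proof. by rewrite lerDl mulr_ge0 ?powR_ge0. Qed.

(** The bound [powR_mean_le] is integrated over each cell and summed: the terms
    [L^-1] contribute at most [1] because the total measure is at most [L], the
    others at most [K * rho f] because the cells are disjoint. *)
Lemma modular_averaging f : measurable_fun [set: T] f -> (rho f <= 1)%E ->
  (rho (averaging f) <= M%:E)%E.
Proof.
move=> mf f1; pose K := 2 `^ P * L `^ delta.
have K0 : 0 <= K by rewrite mulr_ge0 ?powR_ge0.
pose I j := (\int[mu]_(x in A j) (`|f x| `^ r x)%:E)%E.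
have I0 j : (0 <= I j)%E.
  by apply: integral_ge0 => x _; rewrite lee_fin powR_ge0.
have I1 j : (I j <= 1)%E by exact: le_trans (integral_cell_le _ mf) f1.
have Ioo j : (I j < +oo)%E by exact: le_lt_trans (I1 j) (ltry 1).
have Ifin j : I j \is a fin_num by rewrite ge0_fin_numE.
pose c j : R := L^-1 + K * mean mu (A j) (fun x => `|f x| `^ r x).
have c0 j : 0 <= c j.
  rewrite addr_ge0 ?invr_ge0 ?(ltW L0)// mulr_ge0//.
  by apply: mean_ge0 => // x _; exact: powR_ge0.
apply: (@le_trans _ _ (\int[mu]_x \sum_j (c j * \1_(A j) x)%:E)%E).
  rewrite [in leLHS]unlock; apply: ae_ge0_le_integral => //.
  - by apply: measurable_modular => //; exact: measurable_averaging.
  - by move=> x _; apply: sume_ge0 => j _; rewrite lee_fin mulr_ge0.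
  - apply: emeasurable_sum => j; apply/measurable_EFinP.
    by apply: measurable_funM.
  apply: filterS (exponent_ge1 hp pb) => x r1 _.
  have [[j Ajx]|xA] := pselect (exists j, A j x); last first.
    rewrite averaging_out => [|j Ajx]; last by apply: xA; exists j.
    rewrite normr0 powR0 ?gt_eqF ?(lt_le_trans ltr01)//.
    by apply: sume_ge0 => j _; rewrite lee_fin mulr_ge0.
  rewrite (averaging_cell _ Ajx) (bigD1 j)//= indicE mem_set// mulr1.
  apply: (@le_trans _ _ (c j)%:E); last first.
    by rewrite leeDl// sume_ge0// => i _; rewrite lee_fin mulr_ge0.
  rewrite lee_fin; apply: (powR_mean_le hp (mA j) _ _ (@rP j) (@r_osc j)) => //.
    exact: Ioo.
  apply: le_trans (A_ge j); rewrite lerD2l /mean -[leRHS]mulr1.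
  rewrite ler_wpM2l ?invr_ge0 ?fine_ge0// /Rintegral.
  by rewrite -lee_fin (fineK (Ifin j)); exact: I1.
rewrite ge0_integral_sum//; first last.
- by move=> j x _; rewrite lee_fin mulr_ge0.
- move=> j; apply/measurable_EFinP.
  by apply: measurable_funM.
rewrite (eq_bigr (fun j => L^-1%:E * mu (A j) + K%:E * I j)%E); last first.
  move=> j _; under eq_integral do rewrite EFinM.
  rewrite ge0_integralZl_EFin//; last exact/measurable_EFinP/measurable_indic.
  rewrite integral_indic// setIT.
  have mfin : mu (A j) \is a fin_num by rewrite ge0_fin_numE.
  rewrite -(fineK mfin) -(fineK (Ifin j)) -!EFinM -EFinD.
  rewrite /c /mean -/(Rintegral _ _ _); congr EFin.
  rewrite /I; field; rewrite !gt_eqF//; exact: fine_measure_gt0.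
rewrite big_split/= -!ge0_sume_distrr//.
rewrite /M EFinD; apply: leeD.
  apply: (@le_trans _ _ (L^-1%:E * L%:E)%E).
    by rewrite lee_wpmul2l// lee_fin invr_ge0 ltW.
  by rewrite -EFinM mulVf// gt_eqF.
rewrite -[leRHS]mule1 lee_wpmul2l ?lee_fin//.
exact: le_trans (sum_integral_cell_le mf) f1.
Qed.

Lemma averagingZ (c : R) f : measurable_fun [set: T] f -> (N f < +oo)%E ->
  averaging (fun x => c * f x) = (fun x => c * averaging f x).
Proof.
move=> mf Nf; apply/funext => x; rewrite /averaging mulr_sumr.
apply: eq_bigr => j _; rewrite meanZ ?mulrA//.
exact: integrable_of_luxemburg_norm.
Qed.

Lemma luxemburg_norm_averaging f (l : R) : measurable_fun [set: T] f ->
  (N f < l%:E)%E -> (N (averaging f) <= (M * l)%:E)%E.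
Proof.
move=> mf Nfl; have [l0 fl] := luxemburg_norm_lt hp pb mf Nfl.
have M0 : 0 < M by exact: lt_le_trans M1.
apply: luxemburg_norm_le; first exact: mulr_gt0.
have mfl : measurable_fun [set: T] (fun x => f x / l) by exact: measurable_funM.
rewrite (_ : (fun x => _) = (fun x => averaging (fun y => f y / l) x / M)).
  apply: (modular_div_le1 hp pb) => //; first exact: measurable_averaging.
  exact: modular_averaging.
have -> : (fun y => f y / l) = (fun y => l^-1 * f y).
  by apply/funext => y; rewrite mulrC.
rewrite averagingZ//; last exact: lt_trans (ltry l).
by apply/funext => x; field; rewrite !gt_eqF.
Qed.

End averaging.

(** * The averaging operator on classes of functions *)

Section averaging_operator.
Context d (T : measurableType d) (R : realType).
Variables (mu : {measure set T -> \bar R}) (p : T -> \bar R).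
Hypotheses (hp : variable_exponent p) (pb : (ess_sup mu p < +oo)%E).
Local Notation r := (fun x => fine (p x)).
Local Notation N := (luxemburg_norm mu p).
Local Notation V := (vLspace hp pb).
Local Notation "\pi f" := (\pi_(vLspace hp pb) f)%qT (at level 10).

Lemma norm_pi_vLspace (f : vLfun hp pb) : (`|\pi f|)%:E = N f.
Proof. exact: vL_norm_pi. Qed.

Lemma pi_vLspace_sum (J : finType) (c : J -> R) (u : J -> vLfun hp pb) :
  \pi (\sum_j c j *: u j) = \sum_j c j *: \pi (u j).
Proof.
have pi0 : \pi (0 : vLfun hp pb) = 0.
  by rewrite -(scale0r 0) pi_vLspaceZ scale0r.
rewrite (big_morph _ (@pi_vLspaceD _ _ _ _ _ hp pb) pi0).
by apply: eq_bigr => j _; rewrite pi_vLspaceZ.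
Qed.

Lemma vLfun_sumE (J : finType) (c : J -> R) (u : J -> vLfun hp pb) (x : T) :
  (\sum_j c j *: u j) x = \sum_j c j * u j x.
Proof. by elim/big_rec2: _ => //= j a b _ <-. Qed.

Lemma repr_linear_ae (a : R) (f g : V) :
  repr (a *: f + g) = (fun x => a * repr f x + repr g x) %[ae mu].
Proof.
have -> : a *: f + g = \pi (a *: repr f + repr g).
  by rewrite pi_vLspaceD pi_vLspaceZ !reprK.
exact: repr_vLspace.
Qed.

Lemma indicator_in_vLfun (A : set T) : measurable A -> (mu A < +oo)%E ->
  \1_A \in vLfun_pred mu p.
Proof.
move=> mA Aoo; have mI : measurable_fun [set: T] (\1_A : T -> R) by [].
have Afin : mu A \is a fin_num by rewrite ge0_fin_numE.
apply/vLfun_predP; split => //.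
apply: (@le_lt_trans _ _ (1 + fine (mu A))%:E); last exact: ltry.
apply: luxemburg_norm_le_modular => //; first by rewrite lerDl fine_ge0.
apply: (@le_trans _ _ (mu A)); last first.
  by rewrite EFinD fineK// leeDr.
rewrite -[X in (_ <= mu X)%E]setIT -integral_indic// [in leLHS]unlock.
apply: ae_ge0_le_integral => //.
- exact: measurable_modular.
- exact/measurable_EFinP.
apply: filterS (exponent_ge1 hp pb) => x r1 _; rewrite lee_fin indicE.
by case: (x \in A); rewrite ?normr1 ?normr0 ?powR1 ?powR0// gt_eqF// (lt_le_trans ltr01).
Qed.

Variables (J : finType) (A : J -> set T) (P delta L : R).
Hypotheses (mA : forall j, measurable (A j)) (tA : trivIset [set: J] A).
Hypotheses (A0 : forall j, (0 < mu (A j))%E) (Aoo : forall j, (mu (A j) < +oo)%E).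
Hypothesis rP : forall j x, A j x -> 1 <= r x <= P.
Hypothesis r_osc : forall j x y, A j x -> A j y -> `|r x - r y| <= delta.
Hypothesis AL : (\sum_j mu (A j) <= L%:E)%E.
Hypothesis A_ge : forall j, 1 + (fine (mu (A j)))^-1 <= L.
Hypothesis L0 : 0 < L.

(* The operator is defined by its coefficients in the indicators of the cells, so
   that finite rank is immediate. *)
Let ind j := VLfun hp pb (indicator_in_vLfun (mA j) (Aoo j)).
Let F (f : V) : V := \sum_j mean mu (A j) (repr f) *: \pi (ind j).

Let F_linear : linear F.
Proof.
move=> a f g; rewrite /F scaler_sumr -big_split/=; apply: eq_bigr => j _.
rewrite scalerA -scalerDl; congr (_ *: _).
have fi h : mu.-integrable (A j) (EFin \o (repr h : vLfun hp pb)).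
  apply: (integrable_of_luxemburg_norm hp pb mA Aoo rP).
    exact: vLfun_measurable.
  exact: vLfun_norm_lty.
rewrite -meanZ// -meanD//; last exact: integrable_mull.
rewrite /mean; congr (_ * fine _); apply: ae_eq_integral => //.
- by apply/measurable_EFinP/measurable_funTS; exact: vLfun_measurable.
- apply/measurable_EFinP/measurable_funTS/measurable_funD.
    by apply: measurable_funM => //; exact: vLfun_measurable.
  exact: vLfun_measurable.
by apply: filterS (repr_linear_ae a f g) => x /(_ I) -> _.
Qed.

Let F_pi (f : V) : F f = \pi (\sum_j mean mu (A j) (repr f) *: ind j).
Proof. by rewrite pi_vLspace_sum. Qed.

Let averagingE (f : V) :
  (\sum_j mean mu (A j) (repr f) *: ind j : vLfun hp pb) =
  averaging mu A (repr f : vLfun hp pb) :> (T -> R).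
Proof. by apply/funext => x; rewrite vLfun_sumE. Qed.

(** The operator norm is stated with a strict bound on [|f|], because that is what
    yields a modular at most [1]; a factor [2] in the final constant
    makes up for the difference. *)
Lemma averaging_operator : exists F : {linear V -> V},
  [/\ finite_rank F,
      forall (f : V) l, `|f| < l -> `|F f| <= (1 + 2 `^ P * L `^ delta) * l &
      forall f : V, `|f - F f|%:E =
        N (fun x => (repr f : vLfun hp pb) x - averaging mu A (repr f : vLfun hp pb) x)].
Proof.
pose FL := GRing.isLinear.Build _ _ _ _ F F_linear.
exists (HB.pack F FL : {linear V -> V}); split => /=.
- exists #|J|, (fun i => \pi (ind (enum_val i))) => f.
  exists (fun i => mean mu (A (enum_val i)) (repr f)).
  by rewrite /F (reindex_onto enum_val enum_rank)/= => [|j _]; rewrite ?enum_rankK//;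
    apply: eq_bigl => i; rewrite enum_valK eqxx.
- move=> f l fl; rewrite -lee_fin F_pi norm_pi_vLspace averagingE.
  apply: (luxemburg_norm_averaging hp pb mA tA A0 Aoo rP r_osc) => //.
    exact: vLfun_measurable.
  by rewrite -norm_pi_vLspace reprK lte_fin.
- move=> f; rewrite F_pi -[f in LHS]reprK -pi_vLspaceN -pi_vLspaceD.
  rewrite norm_pi_vLspace; congr (luxemburg_norm mu p _).
  by apply/funext => x; rewrite -averagingE reprK.
Qed.

End averaging_operator.

(** * Exhaustion by sets of finite measure *)

Section exhaustion.
Context d (T : measurableType d) (R : realType).
Variables (mu : {measure set T -> \bar R}) (p : T -> \bar R).
Hypotheses (hp : variable_exponent p) (pb : (ess_sup mu p < +oo)%E).
Local Notation r := (fun x => fine (p x)).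
Local Notation rho := (modular mu p).
Local Notation N := (luxemburg_norm mu p).

Lemma exponent_bounded_ae :
  exists2 P : R, 1 <= P & \forall x \ae mu, 1 <= r x <= P.
Proof.
exists (Num.max 1 (fine (ess_sup mu p))); first by rewrite le_max lexx.
apply: filterS2 (exponent_ge1 hp pb) (ess_sup_ge mu p) => x r1 px.
rewrite r1/= le_max; apply/orP; right.
move: r1 px pb; case: (p x) => [s| |] /=; rewrite ?ler10//.
by case: (ess_sup mu p).
Qed.

Variable P : R.
Hypotheses (P1 : 1 <= P) (rP_ae : \forall x \ae mu, 1 <= r x <= P).

(** This is where boundedness of the exponent enters: dilating a function
    multiplies its modular by at most a finite constant, so finiteness of the norm gives
    finiteness of the modular at every scale. *)
Lemma modular_div_lty (h : T -> R) (e : R) : measurable_fun [set: T] h ->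
  (N h < +oo)%E -> 0 < e -> (rho (fun x => (h x / e)%R) < +oo)%E.
Proof.
move=> mh Nh e0; pose l := fine (N h) + 1.
have [l0 hl] : 0 < l /\ (rho (fun x => (h x / l)%R) <= 1)%E.
  apply: (luxemburg_norm_lt hp pb) => //.
  by rewrite -(fineK (luxemburg_norm_fin Nh)) lte_fin ltrDl.
pose c := Num.max 1 (l / e); have c1 : 1 <= c by rewrite le_max lexx.
have c0 : 0 <= c by exact: le_trans c1.
have mhl : measurable_fun [set: T] (fun x => h x / l) by exact: measurable_funM.
apply: (@le_lt_trans _ _ ((c `^ P)%:E * rho (fun x => (h x / l)%R))%E); last first.
  by rewrite lte_mul_pinfty ?lee_fin ?powR_ge0// (le_lt_trans hl)// ltry.
rewrite unlock -ge0_integralZl_EFin ?powR_ge0//; first last.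
- exact: measurable_modular.
apply: ae_ge0_le_integral => //.
- by apply: measurable_modular => //; exact: measurable_funM.
- by move=> x _; rewrite mule_ge0// lee_fin powR_ge0.
- by apply: measurable_funeM; exact: measurable_modular.
apply: filterS rP_ae => x /andP[r1 rP] _; rewrite -EFinM lee_fin.
have r0 : 0 <= r x by exact: le_trans r1.
apply: (@le_trans _ _ (c `^ r x * `|h x / l| `^ r x)); last first.
  by rewrite ler_wpM2r ?powR_ge0// ler_powR.
rewrite -powRM// ge0_ler_powR ?nnegrE ?mulr_ge0//.
rewrite (_ : h x / e = (l / e) * (h x / l)); last first.
  by field; rewrite !gt_eqF.
rewrite normrM ler_wpM2r// ger0_norm; last by rewrite divr_ge0 ?ltW.
by rewrite le_max lexx orbT.
Qed.

(** The sets [S n] on which [h] and [r] are bounded, cut by an exhaustion of the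
    measure space, increase to almost everything; the tails tend to [0] by
    dominated convergence. *)
Lemma modular_tail_small (h : T -> R) (e c : R) : sigma_finite [set: T] mu ->
  measurable_fun [set: T] h -> (N h < +oo)%E -> 0 < e -> 0 < c ->
  exists S, exists B : R, [/\ measurable S, (mu S < +oo)%E,
    forall x, S x -> 1 <= r x <= P,
    forall x, S x -> `|h x| <= B &
    (\int[mu]_(x in ~` S) (`|h x / e| `^ r x)%:E <= c%:E)%E].
Proof.
move=> /sigma_finiteP[E [ET homoE mE]] mh Nh e0 c0.
have mhe : measurable_fun [set: T] (fun x => h x / e) by exact: measurable_funM.
have mr := measurable_exponent hp.
pose S n := E n `&` ([set x | `|h x| <= n%:R] `&`
  ([set x | 1 <= r x] `&` [set x | r x <= P])).
have mle (g1 g2 : T -> R) : measurable_fun [set: T] g1 ->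
    measurable_fun [set: T] g2 -> measurable [set x | g1 x <= g2 x].
  by move=> m1 m2; rewrite -[X in measurable X]setTI; exact: measurable_fun_le.
have mS n : measurable (S n).
  apply: measurableI; first exact: (mE n).1.
  apply: measurableI; first by apply: mle => //; exact: measurableT_comp.
  by apply: measurableI; exact: mle.
pose g x : \bar R := (`|h x / e| `^ r x)%:E.
have mg : measurable_fun [set: T] g by exact: measurable_modular.
have g0 x : (0 <= g x)%E by rewrite lee_fin powR_ge0.
pose f n := g \_ (~` S n).
have f_le n x : (`|f n x| <= g x)%E.
  by rewrite /f patchE; case: ifP => _; rewrite ?gee0_abs// abse0.
have gi : mu.-integrable [set: T] g.
  apply/integrableP; split => //.
  rewrite (eq_integral g) => [|x _]; last by rewrite gee0_abs.
  by have := modular_div_lty mh Nh e0; rewrite unlock.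
have mf n : measurable_fun [set: T] (f n).
  apply/(measurable_restrict _ _ _).1 => //; first exact: measurableC.
  exact: measurable_funTS.
have f_cvg : \forall x \ae mu, [set: T] x -> f ^~ x @ \oo --> (cst 0%E : T -> \bar R) x.
  apply: filterS rP_ae => x rPx _; apply: cvg_near_cst.
  have [n0 _ En0] : (\bigcup_i E i) x by rewrite -ET.
  pose n1 := maxn n0 (Num.truncn `|h x|).+1.
  exists n1 => // n /= n1n; rewrite /f patchE memNset//; apply; split.
    have : (n0 <= n)%N by rewrite (leq_trans _ n1n)// leq_maxl.
    by move=> /homoE/subsetPset; exact.
  split; last by move/andP: rPx => [].
  have /andP[_ /ltW hx] := truncn_itv (normr_ge0 (h x)).
  by rewrite /= (le_trans hx)// ler_nat (leq_trans _ n1n)// leq_maxr.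
have [_ _] := dominated_convergence measurableT mf (measurable_cst _) f_cvg gi
  (aeW _ (fun x n _ => f_le n x)).
rewrite integral_cst// mul0e => /fine_cvgP[f_fin /cvgr_lt/(_ c c0) f_lt].
have [n [fn_fin fn_lt]] := filter_ex (filterI f_fin f_lt).
exists (S n), n%:R; split => //.
- apply: le_lt_trans (mE n).2; apply: le_measure.
  + exact/mem_set.
  + exact/mem_set/(mE n).1.
  + by move=> x [].
- by move=> x [_ [_ [r1 rP]]]; rewrite r1.
- by move=> x [_ []].
by rewrite integral_mkcond -[leLHS](fineK fn_fin) lee_fin ltW.
Qed.

End exhaustion.

(** * Cells on which given functions are almost constant *)

Section bins.
Context d (T : measurableType d) (R : realType).
Implicit Types (g : T -> R) (w : R).

(** Meaningful for [0 <= g x < k.+1%:R * w]; all other values of [g x] fall into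
    bin [0]. *)
Definition bin (k : nat) w g (x : T) : 'I_k.+1 := inord (Num.truncn (g x / w)).

Lemma bin_close k w g x y : 0 < w -> 0 <= g x <= k%:R * w ->
  0 <= g y <= k%:R * w -> bin k w g x = bin k w g y -> `|g x - g y| <= w.
Proof.
move=> w0 gx gy /(congr1 val) /=.
have bound z : 0 <= g z <= k%:R * w -> (Num.truncn (g z / w) < k.+1)%N.
  move=> /andP[z0 zk]; rewrite truncn_lt_nat ?divr_ge0 ?(ltW w0)//.
  by rewrite ltr_pdivrMr// (le_lt_trans zk)// ltr_pM2r// ltr_nat.
rewrite !inordK ?bound// => xy.
have /andP[gx0 _] := gx; have /andP[gy0 _] := gy.
have := truncn_itv (divr_ge0 gx0 (ltW w0)).
have := truncn_itv (divr_ge0 gy0 (ltW w0)).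
rewrite xy -natr1 !ler_pdivlMr// !ltr_pdivrMr// !mulrDl !mul1r.
by rewrite ler_norml => /andP[? ?] /andP[? ?]; apply/andP; split; lra.
Qed.

Lemma measurable_bin k w g (i : 'I_k.+1) : measurable_fun [set: T] g ->
  measurable (bin k w g @^-1` [set i]).
Proof.
move=> mg; pose h x : R := (Num.truncn (g x / w))%:R.
have mh : measurable_fun [set: T] h.
  have mt : measurable_fun [set: R] (fun y : R => (Num.truncn y)%:R : R).
    apply: nondecreasing_measurable => // x y xy.
    by rewrite ler_nat le_truncn.
  by apply: (measurableT_comp mt); exact: measurable_funM.
rewrite (_ : _ @^-1` _ = \bigcup_(n in [set n | inord n = i]) (h @^-1` [set n%:R])).
  apply: bigcup_measurable => n _; rewrite -[X in measurable X]setTI.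
  exact: mh.
apply/seteqP; split => [x <-|x [n <-] /=].
  by exists (Num.truncn (g x / w)).
by rewrite /h /bin => /eqP; rewrite eqr_nat => /eqP ->.
Qed.

End bins.

Section partition.
Context d (T : measurableType d) (R : realType).
Variables (mu : {measure set T -> \bar R}).

Lemma sum_measure_trivIset (J : finType) (A : J -> set T) (S : set T) :
  (forall j, measurable (A j)) -> measurable S -> trivIset [set: J] A ->
  (forall j, A j `<=` S) -> (\sum_j mu (A j) <= mu S)%E.
Proof.
move=> mA mS tA AS.
have mI (B : set T) : measurable B ->
    measurable_fun [set: T] (fun x => (\1_B x)%:E : \bar R).
  by move=> mB; apply/measurable_EFinP.
under eq_bigr do rewrite -[X in mu X]setIT -integral_indic//.
rewrite -ge0_integral_sum//; last by move=> j; exact: mI.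
rewrite -[X in (_ <= mu X)%E]setIT -integral_indic//.
apply: ge0_le_integral => //.
- by move=> x _; apply: sume_ge0.
- by apply: emeasurable_sum => j; exact: mI.
- exact: mI.
move=> x _; have [[j Ajx]|xA] := pselect (exists j, A j x); last first.
  rewrite big1 ?lee_fin// => j _; rewrite indicE memNset// => Ajx.
  by apply: xA; exists j.
rewrite (bigD1 j)//= [X in (_ + X)%E]big1 ?adde0 => [|i ij].
  by rewrite !indicE !mem_set//; exact: (AS j).
rewrite indicE memNset// => Aix.
by move/eqP: ij; apply; apply: (tA _ _ I I); exists x.
Qed.

Lemma measure_le_sum_cover (J : finType) (A : J -> set T) (S : set T) :
  (forall j, measurable (A j)) -> measurable S ->
  (forall x, S x -> exists j, A j x) -> (mu S <= \sum_j mu (A j))%E.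
Proof.
move=> mA mS SA.
have mI (B : set T) : measurable B ->
    measurable_fun [set: T] (fun x => (\1_B x)%:E : \bar R).
  by move=> mB; apply/measurable_EFinP.
under eq_bigr do rewrite -[X in mu X]setIT -integral_indic//.
rewrite -ge0_integral_sum//; last by move=> j; exact: mI.
rewrite -[X in (mu X <= _)%E]setIT -integral_indic//.
apply: ge0_le_integral => //.
- exact: mI.
- by apply: emeasurable_sum => j; exact: mI.
move=> x _; rewrite [in leLHS]indicE; have [Sx|Sx] := pselect (S x); last first.
  by rewrite memNset//; apply: sume_ge0.
have [j Ajx] := SA x Sx.
rewrite mem_set// (bigD1 j)//= indicE mem_set// leeDl//.
by apply: sume_ge0.
Qed.

(** With [n] levels for the exponent, [n ^ 2] bounds the inverse measures of the
    cells while the oscillation of the exponent is [P / n]: the power stays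
    bounded because [n <= exp n]. *)
Lemma powR_sqr_le_expR (P : R) (n : nat) : 0 <= P -> (0 < n)%N ->
  (n%:R ^+ 2) `^ (P / n%:R) <= expR (2 * P).
Proof.
move=> P0 n0; have n0' : 0 < n%:R :> R by rewrite ltr0n.
rewrite (_ : 2 * P = (2 * n%:R) * (P / n%:R)); last by field; rewrite gt_eqF.
rewrite expRM ge0_ler_powR ?nnegrE ?divr_ge0 ?expR_ge0 ?exprn_ge0//.
rewrite mulr_natl mulr2n expRD -expr2 ler_pXn2r ?nnegrE ?expR_ge0//.
by apply: le_trans (expR_ge1Dx _); rewrite lerDr.
Qed.

End partition.

Section cells.
Context d (T : measurableType d) (R : realType).
Variables (mu : {measure set T -> \bar R}) (p : T -> \bar R).
Hypothesis hp : variable_exponent p.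
Local Notation r := (fun x => fine (p x)).

(** The requirements under which averaging has norm controlled by
    [1 + 2 `^ P * L `^ delta]. *)
Record admissible_cells (J : finType) (A : J -> set T) (P delta L : R) : Prop :=
  AdmissibleCells {
    cell_measurable : forall j, measurable (A j) ;
    cell_trivIset : trivIset [set: J] A ;
    cell_gt0 : forall j, (0 < mu (A j))%E ;
    cell_lty : forall j, (mu (A j) < +oo)%E ;
    cell_exponent : forall j x, A j x -> 1 <= r x <= P ;
    cell_osc : forall j x y, A j x -> A j y -> `|r x - r y| <= delta ;
    cell_sum : (\sum_j mu (A j) <= L%:E)%E ;
    cell_inv : forall j, 1 + (fine (mu (A j)))^-1 <= L ;
    cell_L_gt0 : 0 < L }.

Variable P : R.
Hypothesis P1 : 1 <= P.

(** The essential point is that [L `^ delta] is bounded in terms of [P] only,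
    whatever the functions [u] and the tolerances [eta] and [k0]. *)
Lemma exists_admissible_cells (I : finType) (u : I -> T -> R) (S : set T)
    (B eta k0 : R) :
  (forall i, measurable_fun [set: T] (u i)) -> measurable S ->
  (mu S < +oo)%E -> (forall x, S x -> 1 <= r x <= P) ->
  (forall i x, S x -> `|u i x| <= B) -> 0 < eta -> 0 < k0 ->
  exists (J : finType) (A : J -> set T) (delta L : R),
    [/\ admissible_cells A P delta L, L `^ delta <= expR (2 * P),
        forall j, A j `<=` S,
        forall j i x y, A j x -> A j y -> `|u i x - u i y| <= eta &
        (mu (S `\` \bigcup_j A j) <= k0%:E)%E].
Proof.
move=> mu_ mS Soo rP uB eta0 k00; pose W := fine (mu S).
have W0 : 0 <= W by exact: fine_ge0.
have SW : mu S = W%:E by rewrite fineK// ge0_fin_numE.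
have P0 : 0 < P by exact: lt_le_trans P1.
(* The values of [u i + B] lie in [0, 2 * B], which [k] bins of width [eta]
   cover. *)
pose k := (Num.truncn (2 * B / eta)).+1.
pose Cu := {ffun I -> 'I_k.+1}.
have Cu_gt0 : (0 < #|Cu|)%N by rewrite card_ffun card_ord expn_gt0.
(* There are [(n + 1) * #|Cu|] cells, so the kept ones have inverse measure at
   most [(n + 1) * #|Cu| / k0]; [n > 2 * D] makes one plus this quantity, and
   [W], at most [n ^ 2]. *)
pose D : R := 1 + W + #|Cu|%:R / k0.
have D1 : 1 <= D by rewrite /D -addrA lerDl addr_ge0// divr_ge0// ltW.
pose n := (Num.truncn (2 * D)).+1.
have Dn : 2 * D < n%:R.
  have D20 : 0 <= 2 * D by rewrite mulr_ge0// (le_trans _ D1).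
  by have /andP[] := truncn_itv D20.
have n0 : 0 < n%:R :> R by rewrite ltr0n.
pose C : finType := ('I_n.+1 * Cu)%type.
pose c x : C := (bin n (P / n%:R) r x, [ffun i => bin k eta (fun y => u i y + B) x]).
have CE : #|C| = (n.+1 * #|Cu|)%N by rewrite card_prod card_ord.
have C0 : 0 < #|C|%:R :> R by rewrite ltr0n CE muln_gt0.
(* Cells of measure below [kap] are discarded; all of them together have measure
   at most [k0]. *)
pose kap := k0 / #|C|%:R.
have kap0 : 0 < kap by exact: divr_gt0.
pose cell z := S `&` c @^-1` [set z].
have mcell z : measurable (cell z).
  case: z => a b; apply: measurableI => //.
  rewrite (_ : c @^-1` [set (a, b)] = (bin n (P / n%:R) r @^-1` [set a]) `&`
      \bigcap_(i in [set: I]) (bin k eta (fun y => u i y + B) @^-1` [set b i])).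
    apply: measurableI; first exact: measurable_bin (measurable_exponent hp).
    apply: fin_bigcap_measurable => [|i _]; first exact: finite_finset.
    by apply: measurable_bin; exact: measurable_funD.
  apply/seteqP; split => [x [<- <-]|x [/= xa xb]].
    by split => // i _; rewrite /= ffunE.
  rewrite /c -xa; congr pair; apply/ffunP => i.
  by rewrite ffunE; exact: (xb i Logic.I).
have cellS z : cell z `<=` S by move=> x [].
have cell_le z : (mu (cell z) <= mu S)%E.
  by apply: le_measure; rewrite ?inE.
have cell_oo z : (mu (cell z) < +oo)%E by exact: le_lt_trans (cell_le z) Soo.
pose J : finType := {z : C | kap <= fine (mu (cell z))}.
pose A (j : J) := cell (val j).
have tA : trivIset [set: J] A.
  by move=> j1 j2 _ _ [x [[_ x1] [_ x2]]]; apply: val_inj; rewrite -x1 -x2.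
have r_bin x y : S x -> S y -> c x = c y -> `|r x - r y| <= P / n%:R.
  move=> Sx Sy [xy _]; apply: (bin_close _ _ _ xy); first exact: divr_gt0.
    have /andP[r1 rleP] := rP x Sx.
    by rewrite (le_trans ler01)//= mulrCA divff ?mulr1// gt_eqF.
  have /andP[r1 rleP] := rP y Sy.
  by rewrite (le_trans ler01)//= mulrCA divff ?mulr1// gt_eqF.
have u_range i x : S x -> 0 <= u i x + B <= k%:R * eta.
  move=> Sx; have := uB i x Sx; rewrite ler_norml => /andP[uB1 uB2].
  have B0 : 0 <= B by exact: le_trans (uB i x Sx).
  have : 2 * B < k%:R * eta.
    have B20 : 0 <= 2 * B / eta by rewrite divr_ge0 ?mulr_ge0// ltW.
    by rewrite -ltr_pdivrMr//; have /andP[] := truncn_itv B20.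
  by move=> h; apply/andP; split; lra.
have u_bin i x y : S x -> S y -> c x = c y -> `|u i x - u i y| <= eta.
  move=> Sx Sy [_ /ffunP/(_ i)]; rewrite !ffunE => xy.
  have := bin_close (g := fun z => u i z + B) eta0 (u_range i x Sx) (u_range i y Sy) xy.
  by rewrite opprD addrACA subrr addr0.
exists J, A, (P / n%:R), (n%:R ^+ 2); split.
- have Dk : #|Cu|%:R / k0 = D - 1 - W by rewrite /D; lra.
  have Q0 : 0 <= D - 1 - W by rewrite -Dk divr_ge0// ltW.
  have n_ge1 : 1 <= n%:R :> R by rewrite ler1n.
  have n_sqr : n%:R <= n%:R ^+ 2 :> R by rewrite expr2 ler_peMr// ltW.
  split.
  + by move=> j; exact: mcell.
  + exact: tA.
  + move=> j; have := lt_le_trans kap0 (valP j).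
    by rewrite -lte_fin fineK// ge0_fin_numE//; exact: cell_oo.
  + by move=> j; exact: cell_oo.
  + by move=> j x [Sx _]; exact: rP.
  + by move=> j x y [Sx xj] [Sy yj]; apply: r_bin => //; rewrite xj yj.
  + apply: (@le_trans _ _ (mu S)).
      by apply: sum_measure_trivIset => // j; [exact: mcell|exact: cellS].
    by rewrite SW lee_fin; lra.
  + move=> j; apply: (@le_trans _ _ (1 + kap^-1)).
      have kapj : kap <= fine (mu (A j)) := valP j.
      by rewrite lerD2l lef_pV2 ?posrE// (lt_le_trans kap0).
    rewrite /kap invf_div CE natrM -mulrA Dk -natr1.
    have : (n%:R + 1) * (D - 1 - W) <= (n%:R + 1) * (n%:R / 2 - 1).
      by apply: ler_wpM2l; lra.
    by rewrite expr2 in n_sqr *; nra.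
  + by rewrite exprn_gt0.
- by apply: powR_sqr_le_expR => //; exact: ltW.
- by move=> j; exact: cellS.
- by move=> j i x y [Sx xj] [Sy yj]; apply: u_bin => //; rewrite xj yj.
pose small : finType := {z : C | ~~ (kap <= fine (mu (cell z)))}.
apply: (@le_trans _ _ (\sum_(j : small) mu (cell (val j)))%E).
  apply: measure_le_sum_cover => //.
    apply: measurableD => //; apply: fin_bigcup_measurable => [|j _].
      exact: finite_finset.
    exact: mcell.
  move=> x [Sx xA]; have [xk|xk] := boolP (kap <= fine (mu (cell (c x)))).
    by exfalso; apply: xA; exists (exist _ (c x) xk).
  by exists (exist _ (c x) xk).
apply: (@le_trans _ _ (\sum_(j : small) kap%:E)%E).
  apply: lee_sum => j _; rewrite -[mu _]fineK ?ge0_fin_numE//.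
  by rewrite lee_fin ltW// ltNge (valP j).
rewrite sumEFin lee_fin sumr_const -mulr_natr /kap mulrAC ler_pdivrMr//.
rewrite ler_pM2l// ler_nat card_sub.
exact: max_card.
Qed.

End cells.

(** * Approximation of finitely many functions, and of compact sets *)

Section approximation.
Context d (T : measurableType d) (R : realType).
Variables (mu : {measure set T -> \bar R}) (p : T -> \bar R).
Hypotheses (hp : variable_exponent p) (pb : (ess_sup mu p < +oo)%E).
Hypothesis mu_sigma_finite : sigma_finite [set: T] mu.
Local Notation r := (fun x => fine (p x)).
Local Notation N := (luxemburg_norm mu p).
Local Notation V := (vLspace hp pb).

Lemma mean_close (A : set T) (f : T -> R) (eta : R) (x : T) : measurable A ->
  (0 < mu A)%E -> (mu A < +oo)%E -> mu.-integrable A (EFin \o f) -> A x ->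
  (forall y, A y -> `|f x - f y| <= eta) -> `|f x - mean mu A f| <= eta.
Proof.
move=> mA A0 Aoo fi Ax fxy.
have ci : mu.-integrable A (EFin \o cst (f x)) by exact: integrable_cst.
have bi : mu.-integrable A (EFin \o (fun y => f x - f y)).
  by apply: eq_integrable (integrableB mA ci fi) => // y _.
rewrite -[X in `|X - _|](mean_cst mA A0 Aoo (f x)) -meanB//.
apply: (le_trans (le_norm_mean mA A0 Aoo bi)).
rewrite -[leRHS](mean_cst mA A0 Aoo); apply: le_mean => //.
- exact: integrable_norm.
- exact: integrable_cst.
Qed.

(** The modular of the error divided by [e] is at most [1]: a third comes from
    the tail outside [S], a third from the kept cells, where the error is at most
    the oscillation of the functions, and a third from the discarded cells, where
    the functions are bounded and the measure is small. *)
Lemma finite_rank_approximation (P : R) (I : finType) (f : I -> V) (e : R) :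
  1 <= P -> (\forall x \ae mu, 1 <= r x <= P) -> 0 < e ->
  exists F : {linear V -> V}, [/\ finite_rank F,
    forall (g : V) l, `|g| < l -> `|F g| <= (1 + 2 `^ P * expR (2 * P)) * l &
    forall i, `|f i - F (f i)| <= e].
Proof.
move=> P1 rP e0; pose u i : T -> R := (repr (f i) : vLfun hp pb).
have mu_ i : measurable_fun [set: T] (u i) by exact: vLfun_measurable.
have Nu i : (N (u i) < +oo)%E by exact: vLfun_norm_lty.
(* One dominating function provides a set [S] suitable for all the [f i]. *)
pose h x := \sum_i `|u i x|.
have mh : measurable_fun [set: T] h.
  by apply: measurable_sum => i; exact: measurableT_comp.
have uh i x : `|u i x| <= `|h x|.
  rewrite [leRHS]ger0_norm ?sumr_ge0// /h (bigD1 i)//= lerDl.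
  by rewrite sumr_ge0.
have Nh : (N h < +oo)%E.
  suff : forall s : seq I, measurable_fun [set: T] (fun x => \sum_(i <- s) `|u i x|) /\
      (N (fun x => (\sum_(i <- s) `|u i x|)%R) < +oo)%E by case/(_ (index_enum I)).
  elim=> [|i s [ms Ns]].
    under eq_fun do rewrite big_nil.
    by split => //; rewrite (luxemburg_norm0 hp pb).
  have mi : measurable_fun [set: T] (fun x => `|u i x|) by exact: measurableT_comp.
  under eq_fun do rewrite big_cons.
  split; first exact: measurable_funD.
  apply: (le_lt_trans (luxemburg_normD hp pb mi ms)); rewrite lte_add_pinfty//.
  apply: le_lt_trans (Nu i); apply: (le_luxemburg_norm hp pb) => //.
  by apply: nearW => x; rewrite normr_id.
have third0 : 0 < 3^-1 :> R by rewrite invr_gt0.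
have [S [B0 [mS Soo rPS hB tail]]] :=
  modular_tail_small hp pb rP mu_sigma_finite mh Nh e0 third0.
pose B := Num.max B0 e.
have eB : e <= B by rewrite le_max lexx orbT.
have B0' : 0 < B by exact: lt_le_trans eB.
have Be1 : 1 <= B / e by rewrite ler_pdivlMr// mul1r.
have uB i x : S x -> `|u i x| <= B.
  move=> Sx; apply: (le_trans (uh i x)); apply: (le_trans (hB x Sx)).
  by rewrite le_max lexx.
pose W := fine (mu S); have W0 : 0 <= W by exact: fine_ge0.
have SW : mu S = W%:E by rewrite fineK// ge0_fin_numE.
(* [q] is the relative oscillation allowed on a cell, so that [q * W] is at most a
   third. *)
pose q := (3 * (W + 1))^-1.
have q0 : 0 < q by rewrite invr_gt0; lra.
have q1 : q <= 1 by rewrite invf_le1; lra.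
pose b := (B / e) `^ P.
have b0 : 0 < b by rewrite powR_gt0// divr_gt0.
have eta0 : 0 < q * e by exact: mulr_gt0.
have k00 : 0 < (3 * b)^-1 by rewrite invr_gt0 mulr_gt0.
have [J [A [delta [L [adm Lb AS osc small]]]]] :=
  exists_admissible_cells hp P1 mu_ mS Soo rPS uB eta0 k00.
have [mA tA A0 Aoo rA rosc AL A_ge L0] := adm.
have [F [rkF normF devF]] :=
  averaging_operator hp pb mA tA A0 Aoo rA rosc AL A_ge L0.
exists F; split => //.
  move=> g l gl; apply: (le_trans (normF g l gl)).
  have l0 : 0 <= l by apply: le_trans (ltW gl).
  by rewrite ler_wpM2r// lerD2l ler_wpM2l// powR_ge0.
move=> i; rewrite -lee_fin devF -/(u i).
set v := averaging mu A (u i).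
have mv : measurable_fun [set: T] v by exact: measurable_averaging.
have mw : measurable_fun [set: T] (fun x => (u i x - v x) / e).
  by apply: measurable_funM => //; exact: measurable_funB.
apply: luxemburg_norm_le => //.
pose D := S `\` \bigcup_j A j.
have mD : measurable D.
  apply: measurableD => //; apply: fin_bigcup_measurable => [|j _].
    exact: finite_finset.
  exact: mA.
pose g x : \bar R := (`|h x / e| `^ r x)%:E.
have mg : measurable_fun [set: T] g.
  by apply: measurable_modular => //; exact: measurable_funM.
have g0 x : (0 <= g x)%E by rewrite lee_fin powR_ge0.
(* The error is dominated by [g1] outside [S], by [g2] on the kept cells and by
   [g3] on the discarded part [D] of [S]. *)
pose g1 := g \_ (~` S).
have mg1 : measurable_fun [set: T] g1.
  apply/(measurable_restrict _ _ _).1 => //; first exact: measurableC.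
  exact: measurable_funTS.
have g10 x : (0 <= g1 x)%E by rewrite /g1 patchE; case: ifP.
pose g2 x : \bar R := (q%:E * (\1_S x)%:E)%E.
pose g3 x : \bar R := (b%:E * (\1_D x)%:E)%E.
have mI (E : set T) : measurable E ->
    measurable_fun [set: T] (fun x => (\1_E x)%:E : \bar R).
  by move=> mE; apply/measurable_EFinP.
have mg2 : measurable_fun [set: T] g2 by apply: measurable_funeM; exact: mI.
have mg3 : measurable_fun [set: T] g3 by apply: measurable_funeM; exact: mI.
have g20 x : (0 <= g2 x)%E by rewrite mule_ge0// lee_fin ltW.
have g30 x : (0 <= g3 x)%E by rewrite mule_ge0// lee_fin ltW.
apply: (@le_trans _ _ (\int[mu]_x (g1 x + g2 x + g3 x))%E).
  rewrite [in leLHS]unlock; apply: ae_ge0_le_integral => //.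
  - exact: measurable_modular.
  - by move=> x _; rewrite !adde_ge0.
  - by apply: emeasurable_funD => //; exact: emeasurable_funD.
  apply: filterS rP => x /andP[r1 rleP] _.
  have r0 : 0 <= r x by exact: le_trans r1.
  have [Sx|Sx] := pselect (S x); last first.
    apply: (@le_trans _ _ (g1 x)); last by rewrite -addeA leeDl// adde_ge0.
    rewrite /g1 patchE mem_set// lee_fin ge0_ler_powR ?nnegrE//.
    rewrite /v averaging_out ?subr0 => [|j /AS//].
    by rewrite !normrM ler_wpM2r.
  have [[j Ajx]|xA] := pselect (exists j, A j x).
    apply: (@le_trans _ _ (g2 x)); last by rewrite -addeA addeCA leeDl// adde_ge0.
    rewrite /g2 indicE mem_set// mule1 lee_fin.
    have close : `|(u i x - v x) / e| <= q.
      rewrite normrM normfV (gtr0_norm e0) ler_pdivrMr//.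
      rewrite /v (averaging_cell mu tA _ Ajx); apply: mean_close => //.
        exact: (integrable_of_luxemburg_norm hp pb mA Aoo rA).
      by move=> y Ajy; exact: osc Ajx Ajy.
    apply: (@le_trans _ _ (q `^ r x)); first by rewrite ge0_ler_powR ?nnegrE// ltW.
    by rewrite ge1r_powR// q0 q1.
  apply: (@le_trans _ _ (g3 x)); last by rewrite leeDr// adde_ge0.
  rewrite /g3 indicE mem_set ?mule1 ?lee_fin; last first.
    by split => // -[j _ Ajx]; apply: xA; exists j.
  rewrite /v averaging_out ?subr0 => [|j Ajx]; last by apply: xA; exists j.
  apply: (@le_trans _ _ ((B / e) `^ r x)); last by rewrite ler_powR.
  rewrite ge0_ler_powR ?nnegrE ?divr_ge0 ?(ltW B0') ?(ltW e0)//.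
  by rewrite normrM normfV (gtr0_norm e0) ler_wpM2r ?invr_ge0 ?(ltW e0)// uB.
rewrite ge0_integralD//; first last.
- exact: emeasurable_funD.
- by move=> x _; rewrite adde_ge0.
rewrite ge0_integralD// -integral_mkcond.
rewrite !ge0_integralZl_EFin ?(ltW q0) ?(ltW b0)//; try exact: mI.
rewrite !integral_indic// !setIT.
have -> : (1 = (3^-1)%:E + (3^-1)%:E + (3^-1)%:E :> \bar R)%E.
  by rewrite -!EFinD; congr EFin; lra.
apply: leeD; last first.
  apply: (@le_trans _ _ (b%:E * ((3 * b)^-1)%:E)%E).
    by rewrite lee_wpmul2l// lee_fin ltW.
  by rewrite -EFinM lee_fin invfM mulrCA divff ?mulr1// gt_eqF.
apply: leeD => //.
rewrite SW -EFinM lee_fin /q invfM -mulrA ler_piMr// mulrC ler_pdivrMr; lra.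
Qed.

End approximation.

Theorem theorem2p4 (d : measure_display) (T : measurableType d) (R : realType)
    (mu : {measure set T -> \bar R})
    (mu_sigma_finite : sigma_finite [set: T] mu)
    (mu_complete : measure_is_complete mu)
    (p : T -> \bar R) (hp : variable_exponent p)
    (pb : (ess_sup mu p < +oo)%E) :
  bounded_approximation_property (vLspace hp pb).
Proof.
have [P P1 rP] := exponent_bounded_ae hp pb.
pose M : R := 1 + 2 `^ P * expR (2 * P).
have M1 : 1 <= M by rewrite lerDl mulr_ge0 ?powR_ge0 ?expR_ge0.
have M0 : 0 < M by exact: lt_le_trans M1.
exists (M * 2) => [|K cK e e0]; first exact: mulr_gt0.
pose e' := e / (2 + M).
have e'0 : 0 < e' by rewrite divr_gt0// addr_gt0.
have : cover_compact K by rewrite -compact_cover.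
move=> /(_ (vLspace hp pb) setT (fun z => ball z e')).
case=> [z _|x Kx|D _ KD].
- exact: ball_open.
- by exists x => //; exact: ballxx.
have [F [rkF normF devF]] :=
  finite_rank_approximation mu_sigma_finite (fun z : D => val z) P1 rP e'0.
exists F; split => //.
- move=> l; exists (M * (l + 1)) => x xl; apply: normF.
  by rewrite (le_lt_trans xl)// ltrDl.
- apply: ge_ereal_sup => _ [x /= x1 <-]; rewrite lee_fin; apply: normF.
  by rewrite (le_lt_trans x1)// ltr1n.
move=> x /KD[z /= zD]; rewrite -ball_normE /= => xz.
have -> : x - F x = (x - z) + (z - F z) + F (z - x).
  by rewrite linearB !addrA !subrK.
have Fzx : `|F (z - x)| <= M * e' by exact: normF xz.
have zFz : `|z - F z| <= e' by exact: (devF (FSetSub zD)).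
rewrite distrC in xz.
apply: (le_lt_trans (ler_normD _ _)); have := ler_normD (x - z) (z - F z).
have -> : e = e' * (2 + M) by rewrite divfK// gt_eqF// addr_gt0.
by lra.
Qed.
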